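(* Let $\mathfrak h\subseteq\Phi^+$ be a Hessenberg set. Then for every $x\in W$ there exists a flow-up class at $x$ in $H_T^*(\mathfrak h)$, and the GKM ring $H_T^*(\mathfrak h)$ has a basis (as a free $\mathbb R[\alpha_1,\dots,\alpha_k]$-module) consisting of flow-up classes, one at each $x\in W$.
   Context: Let $V$ be a finite-dimensional real vector space with a symmetric positive definite bilinear form; for nonzero $\alpha$, $s_\alpha$ is the orthogonal reflection through $\alpha$. Let $\Phi\subset V$ be a crystallographic root system with base $\Delta=\{\alpha_1,\dots,\alpha_k\}$, positive roots $\Phi^+$, $\Phi^-=-\Phi^+$, and Weyl group $W$ (generated by $s_{\alpha_i}$), acting on $\mathbb R[\Delta]=\mathbb R[\alpha_1,\dots,\alpha_k]$. Write $\alpha\prec\beta$ if $\beta-\alpha$ is a sum of positive roots. A Hessenberg set is a subset $\mathfrak h\subseteq\Phi^+$ whose complement in $\Phi^+$ is upward closed for $\prec$. The Hessenberg graph $\Gamma_{\mathfrak h}$ has vertex set $W$ and a directed edge $u\to w$ whenever $w=s_\alpha u$, $\alpha\in\Phi^+$ and $w^{-1}\alpha\in-\mathfrak h$. The GKM ring $H_T^*(\mathfrak h)$ is the ring of maps $\mathcal P:W\to\mathbb R[\Delta]$ with $\mathcal P(w)-\mathcal P(s_\alpha w)\in\langle\alpha\rangle$ for every edge of $\Gamma_{\mathfrak h}$ joining $w$ and $s_\alpha w$; $\mathcal P\in H_T^d(\mathfrak h)$ means every nonzero $\mathcal P(w)$ is homogeneous of degree $d$. Write $x<_{\mathfrak h}y$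 if there is a directed path $x\to\cdots\to y$ in $\Gamma_{\mathfrak h}$, and let $\ell_{\mathfrak h}(x)$ be the number of edges of $\Gamma_{\mathfrak h}$ ending at $x$. A flow-up class at $x$ is $\mathcal P^x\in H_T^{\ell_{\mathfrak h}(x)}(\mathfrak h)$ such that (1) $\mathcal P^x(x)=\prod\alpha$, the product over all edges $s_\alpha x\to x$ of $\Gamma_{\mathfrak h}$ ending at $x$, and (2) $\mathcal P^x(y)\neq0$ implies $y=x$ or $x<_{\mathfrak h}y$. *)

(* Defs.v *)
From HB Require Import structures.
From Stdlib Require Import Reals ClassicalEpsilon Relations.
From mathcomp Require Import all_boot all_order all_algebra.
From mathcomp Require Import Rstruct.
From mathcomp Require Import mpoly.

Set Implicit Arguments.
Unset Strict Implicit.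
Unset Printing Implicit Defensive.

Import Order.TTheory GRing.Theory Num.Theory.
Local Open Scope ring_scope.

Definition pb (P : Prop) : bool :=
  if excluded_middle_informative P then true else false.

Section Hessenberg.
(* V = 'rV[R]_n (row vectors); linear maps act on the right: v |-> v *m M.
   So the composite "s_a after u" has matrix  u *m S_a, and w^{-1} a = a *m invmx w. *)
Variables (n k : nat).
Local Notation vec := 'rV[R]_n.

Definition form (B : 'M[R]_n) (u v : vec) : R := (u *m B *m v^T) 0 0.

Definition sym_posdef (B : 'M[R]_n) : Prop :=
  B^T = B /\ forall v : vec, v != 0 -> 0 < form B v v.

(* orthogonal reflection s_a(v) = v - 2 (v,a)/(a,a) a, as a matrix *)
Definition refl (B : 'M[R]_n) (a : vec) : 'M[R]_n :=
  1%:M - (2 / form B a a) *: (B *m a^T *m a).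

Definition root_system (B : 'M[R]_n) (Phi : seq vec) : Prop :=
  [/\ uniq Phi,
      0 \notin Phi &
      (forall v : vec, exists c : vec -> R, v = \sum_(a <- Phi) c a *: a)] /\
  [/\ (forall a c, a \in Phi -> c *: a \in Phi -> c = 1 \/ c = -1),
      (forall a b, a \in Phi -> b \in Phi -> b *m refl B a \in Phi) &
      (forall a b, a \in Phi -> b \in Phi ->
         exists z : int, 2 * form B b a / form B a a = z%:~R)].

Definition simple (D : 'M[R]_(k, n)) (i : 'I_k) : vec := row i D.

Definition is_base (Phi : seq vec) (D : 'M[R]_(k, n)) : Prop :=
  [/\ (forall i, simple D i \in Phi),
      row_free D &
      (forall b, b \in Phi -> exists c : 'I_k -> int,
          b = \sum_(i < k) (c i)%:~R *: simple D i /\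
          ((forall i, 0 <= c i) \/ (forall i, c i <= 0)))].

(* coordinates of a vector in the span of the base *)
Definition coord (D : 'M[R]_(k, n)) (a : vec) : 'rV[R]_k := a *m pinvmx D.

(* the root a viewed as an element of R[alpha_1..alpha_k] *)
Definition lin (D : 'M[R]_(k, n)) (a : vec) : {mpoly R[k]} :=
  \sum_(i < k) coord D a 0 i *: 'X_i.

Definition posroots (Phi : seq vec) (D : 'M[R]_(k, n)) : seq vec :=
  [seq a <- Phi | [forall i, 0 <= coord D a 0 i]].

Definition rprec (Phi : seq vec) (D : 'M[R]_(k, n)) (a b : vec) : Prop :=
  exists s : seq vec, all (mem (posroots Phi D)) s /\ b - a = \sum_(g <- s) g.

Definition hessenberg (Phi : seq vec) (D : 'M[R]_(k, n)) (h : pred vec) : Prop :=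
  (forall a, h a -> a \in posroots Phi D) /\
  (forall a b, a \in posroots Phi D -> ~~ h a -> b \in posroots Phi D ->
     rprec Phi D a b -> ~~ h b).

Definition weyl (B : 'M[R]_n) (D : 'M[R]_(k, n)) (w : 'M[R]_n) : Prop :=
  exists l : seq 'I_k, w = foldr (fun i M => M *m refl B (simple D i)) 1%:M l.

Definition hedge B Phi D (h : pred vec) (u : 'M[R]_n) (a : vec) (w : 'M[R]_n) : Prop :=
  [/\ weyl B D u, weyl B D w, a \in posroots Phi D,
      w = u *m refl B a & h (- (a *m invmx w))].

Definition hreach B Phi D h : relation 'M[R]_n :=
  clos_trans _ (fun u w => exists a, hedge B Phi D h u a w).

Definition gkm B Phi D h (P : 'M[R]_n -> {mpoly R[k]}) : Prop :=
  forall u a w, hedge B Phi D h u a w ->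
    exists q : {mpoly R[k]}, P u - P w = q * lin D a.

Definition gkm_deg B Phi D h (d : nat) (P : 'M[R]_n -> {mpoly R[k]}) : Prop :=
  gkm B Phi D h P /\
  forall w, weyl B D w -> P w != 0 -> P w \is ishomog1 d (@mdeg k).

(* number of edges ending at x (edges into x are labelled by distinct a in Phi^+) *)
Definition ell B Phi D h (x : 'M[R]_n) : nat :=
  count (fun a => pb (exists u, hedge B Phi D h u a x)) (posroots Phi D).

Definition flowup B Phi D h (x : 'M[R]_n) (P : 'M[R]_n -> {mpoly R[k]}) : Prop :=
  [/\ gkm_deg B Phi D h (ell B Phi D h x) P,
      P x = \prod_(a <- posroots Phi D | pb (exists u, hedge B Phi D h u a x)) lin D a &
      forall y, weyl B D y -> P y != 0 -> y = x \/ hreach B Phi D h x y].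

End Hessenberg.

(* Main.v *)
Require Import Defs.
From HB Require Import structures.
From Stdlib Require Import Reals ClassicalEpsilon Relations.
From mathcomp Require Import all_boot all_order all_algebra.
From mathcomp Require Import Rstruct.
From mathcomp Require Import mpoly.
From mathcomp Require Import ring lra zify.
Import Order.TTheory GRing.Theory Num.Theory.
Local Open Scope ring_scope.
Set Implicit Arguments.
Unset Strict Implicit.
Unset Printing Implicit Defensive.

(* Only the existence of classes P with P x the product of the labels entering x and
   support among the vertices not below x needs work: spanning, independence, the sharp
   support condition and homogeneity follow by triangular elimination.

   Existence is reduced to the subgraphs of edges whose label lies in a subspace U of
   rank at most 2, by induction on the rank k of the labels. If k >= 3 and all proper
   subspaces are known, a class for U times the product of the labels outside U is a class
   for the whole graph; these products generate all forms of large degree, so every form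
   of large total degree is attained as leading coefficient. One then descends in degree:
   for a linear form l outside every span of two labels, the labels entering a vertex stay
   pairwise independent modulo l, so a class leading with l * g * (product of the labels)
   can be corrected upwards until it is divisible by l, and divided by l it leads with g.

   In rank 2 let x be a vertex and q a simple root of the local positive system with x q
   positive. The Hessenberg set can be replaced by a lower set stable under s_q: removing
   roots that x makes negative costs a linear factor, adding roots that x keeps positive
   costs nothing. Then a divided difference leads from x s_q to x, and one inducts up to
   the local longest element, where the class is supported at a single vertex. *)

(** * Linear forms in a polynomial ring *)

Section LinearForms.
Variable F : fieldType.

Definition lf k (v : 'rV[F]_k) : {mpoly F[k]} := \sum_(i < k) v 0 i *: 'X_i.

Lemma lf_is_linear k : linear (@lf k).
Proof.
move=> c u v; rewrite /lf scaler_sumr -big_split /=; apply: eq_bigr => i _.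
by rewrite !mxE scalerDl scalerA.
Qed.
HB.instance Definition _ k :=
  GRing.isLinear.Build F 'rV[F]_k {mpoly F[k]} _ (@lf k) (@lf_is_linear k).

Lemma lf_delta k i : lf (delta_mx 0 i) = 'X_i :> {mpoly F[k]}.
Proof.
rewrite /lf (bigD1 i) //= mxE !eqxx scale1r big1 ?addr0 // => j ji.
by rewrite mxE (negPf ji) andbF scale0r.
Qed.

Lemma lf_eq0 k (v : 'rV[F]_k) : (lf v == 0) = (v == 0).
Proof.
apply/eqP/eqP => [v0|->]; last exact: linear0.
apply/rowP => i; rewrite mxE; have := congr1 (mcoeff U_(i)) v0.
rewrite mcoeff0 /lf raddf_sum (bigD1 i) //= mcoeffZ mcoeffXU eqxx mulr1.
rewrite big1 ?addr0 // => j ji.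
by rewrite mcoeffZ mcoeffXU (negPf ji) mulr0.
Qed.

Lemma lf_homog k (v : 'rV[F]_k) : lf v \is 1.-homog.
Proof.
by apply: rpred_sum => i _; apply: rpredZ; rewrite dhomogX; apply/eqP; apply: mdeg1.
Qed.

Definition dvdmp k (a f : {mpoly F[k]}) := exists q, f = q * a.

Lemma dvdmp0 k (a : {mpoly F[k]}) : dvdmp a 0.
Proof. by exists 0; rewrite mul0r. Qed.

Lemma dvdmpD k (a f g : {mpoly F[k]}) : dvdmp a f -> dvdmp a g -> dvdmp a (f + g).
Proof. by case=> q -> [r ->]; exists (q + r); rewrite mulrDl. Qed.

Lemma dvdmpN k (a f : {mpoly F[k]}) : dvdmp a f -> dvdmp a (- f).
Proof. by case=> q ->; exists (- q); rewrite mulNr. Qed.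

Lemma dvdmpB k (a f g : {mpoly F[k]}) : dvdmp a f -> dvdmp a g -> dvdmp a (f - g).
Proof. by move=> af ag; apply: dvdmpD => //; apply: dvdmpN. Qed.

Lemma dvdmp_mull k (a g f : {mpoly F[k]}) : dvdmp a f -> dvdmp a (g * f).
Proof. by case=> q ->; exists (g * q); rewrite mulrA. Qed.

Lemma dvdmp_mulr k (a g f : {mpoly F[k]}) : dvdmp a f -> dvdmp a (f * g).
Proof. by rewrite mulrC; apply: dvdmp_mull. Qed.

Lemma dvdmp_refl k (a : {mpoly F[k]}) : dvdmp a a.
Proof. by exists 1; rewrite mul1r. Qed.

Definition subst m k (L : 'M[F]_(m, k)) : {mpoly F[m]} -> {mpoly F[k]} :=
  mmap (@mpolyC k F) (fun i => lf (row i L)).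

HB.instance Definition _ m k (L : 'M[F]_(m, k)) :=
  GRing.RMorphism.on (subst L).

Lemma substZ m k (L : 'M[F]_(m, k)) c p : subst L (c *: p) = c *: subst L p.
Proof. by rewrite -mul_mpolyC rmorphM /= [subst L _]mmapC mul_mpolyC. Qed.

Lemma subst_lf m k (L : 'M[F]_(m, k)) v : subst L (lf v) = lf (v *m L).
Proof.
rewrite /lf rmorph_sum /= (eq_bigr (fun i => v 0 i *: lf (row i L))); last first.
  by move=> i _; rewrite substZ [subst L _]mmapX mmap1U.
rewrite -/(lf (v *m L)) mulmx_sum_row linear_sum /=.
by apply: eq_bigr => i _; rewrite linearZ.
Qed.

(** For [a != 0] this projection has kernel the line of [a]; substituting along it models the
    quotient by [lf a] inside the same polynomial ring. *)
Definition proj k (a : 'rV[F]_k) : 'M[F]_k := 1%:M - pinvmx a *m a.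

Lemma mulmx_pinv_row k (a : 'rV[F]_k) : a != 0 -> a *m pinvmx a = 1%:M.
Proof.
move=> a0; have fa : row_free a by rewrite /row_free rank_rV a0.
apply: (row_free_inj fa); rewrite mulmxKpV ?mul1mx //.
Qed.

Lemma mul_proj k (a : 'rV[F]_k) : a != 0 -> a *m proj a = 0.
Proof. by move=> a0; rewrite mulmxBr mulmx1 mulmxA mulmx_pinv_row // mul1mx subrr. Qed.

Lemma proj_eq0 k (a v : 'rV[F]_k) : v *m proj a = 0 -> (v <= a)%MS.
Proof.
rewrite mulmxBr mulmx1 mulmxA => /eqP; rewrite subr_eq0 => /eqP ->.
exact: submxMl.
Qed.

(** Each variable differs from its image by a multiple of [lf a], and the congruence passes to
    powers, products and sums. *)
Lemma subst_proj_mod k (a : 'rV[F]_k) p : dvdmp (lf a) (p - subst (proj a) p).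
Proof.
elim/mpolyind: p => [|c m p _ _ IH]; first by rewrite rmorph0 subr0; apply: dvdmp0.
rewrite rmorphD /= opprD addrACA; apply: dvdmpD => //; rewrite substZ -scalerBr -mul_mpolyC.
apply: dvdmp_mull; rewrite mpolyXE_id rmorph_prod /=.
elim/big_rec2: _ => [|i x y _ IH1]; first by rewrite subrr; apply: dvdmp0.
rewrite -[X in X - _](subrK (subst (proj a) ('X_i ^+ m i) * y)) -addrA -mulrBr.
apply: dvdmpD; last exact: dvdmp_mull.
rewrite -mulrBl; apply: dvdmp_mulr; elim: (m i) => [|e IHe].
  by rewrite !expr0 rmorph1 subrr; apply: dvdmp0.
rewrite !exprS rmorphM -[X in X - _](subrK (subst (proj a) 'X_i * 'X_i ^+ e)) -addrA.
rewrite -mulrBr -mulrBl; apply: dvdmpD; last exact: dvdmp_mull.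
apply: dvdmp_mulr; rewrite -lf_delta subst_lf -linearB /= mulmxBr mulmx1 opprB addrC subrK.
rewrite mulmxA; set c' := _ *m pinvmx a.
by rewrite [c']mx11_scalar mul_scalar_mx linearZ /= -mul_mpolyC; apply/dvdmp_mull/dvdmp_refl.
Qed.

Lemma dvd_lfP k (a : 'rV[F]_k) f : a != 0 -> dvdmp (lf a) f <-> subst (proj a) f = 0.
Proof.
move=> a0; split=> [[q ->]|f0].
  by rewrite rmorphM /= subst_lf mul_proj // linear0 mulr0.
by have := subst_proj_mod a f; rewrite f0 subr0.
Qed.

(** By [dvd_lfP] the multiples of [lf a] are the kernel of a ring morphism into an integral
    domain. *)
Lemma lf_prime k (a : 'rV[F]_k) f g : a != 0 ->
  dvdmp (lf a) (f * g) -> dvdmp (lf a) f \/ dvdmp (lf a) g.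
Proof.
move=> a0 /(dvd_lfP _ a0); rewrite rmorphM => /eqP; rewrite mulf_eq0.
by case/orP => /eqP h; [left|right]; apply/(dvd_lfP _ a0).
Qed.

Lemma dvd_lf_lf k (a b : 'rV[F]_k) : a != 0 -> dvdmp (lf a) (lf b) -> (b <= a)%MS.
Proof.
move=> a0 /(dvd_lfP _ a0); rewrite subst_lf => /eqP; rewrite lf_eq0 => /eqP.
exact: proj_eq0.
Qed.

(* Distinct linear forms are coprime, so their product divides what each divides. *)
Lemma prod_lf_dvd k (s : seq 'rV[F]_k) f :
  all (fun a => a != 0) s -> pairwise (fun a b => ~~ (b <= a)%MS) s ->
  (forall a, a \in s -> dvdmp (lf a) f) -> dvdmp (\prod_(a <- s) lf a) f.
Proof.
elim: s f => [|a s IH] f /=; first by rewrite big_nil => _ _ _; exists f; rewrite mulr1.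
case/andP=> a0 s0 /andP[/allP as_ ps] div.
have [q Eq] : dvdmp (lf a) f by apply: div; rewrite mem_head.
have [r Er] : dvdmp (\prod_(b <- s) lf b) q.
  apply: IH => // b bs; have b0 := allP s0 _ bs.
  have: dvdmp (lf b) (q * lf a) by rewrite -Eq; apply: div; rewrite inE bs orbT.
  case/(lf_prime b0) => // /(dvd_lf_lf b0) ab; case/negP: (as_ _ bs).
  have /sub_rVP[c Ea] := ab; have c0 : c != 0 by apply: contraNneq a0 => c0;
    rewrite Ea c0 scale0r.
  by apply/sub_rVP; exists c^-1; rewrite Ea scalerA mulVf // scale1r.
by exists r; rewrite big_cons Eq Er -mulrA [lf a * _]mulrC.
Qed.

Lemma prod_lf_homog k (I : Type) (s : seq I) (g : I -> 'rV[F]_k) :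
  \prod_(a <- s) lf (g a) \is (size s).-homog.
Proof.
elim: s => [|a s IH]; first by rewrite big_nil dhomog1.
by rewrite big_cons /= -add1n; apply: dhomogM IH; apply: lf_homog.
Qed.

(** Multiplication by a form of degree [d] shifts homogeneous components by [d], so divisibility by
    a form passes to each component. *)
Lemma pihomog_mulr k d e (p q : {mpoly F[k]}) : p \is d.-homog ->
  pihomog mdeg e (q * p) = if (d <= e)%N then pihomog mdeg (e - d) q * p else 0.
Proof.
move=> hp; rewrite {1}(pihomog_partitionE (leqnn (mmeasure mdeg q))) mulr_suml linear_sum /=.
have H i : pihomog mdeg e (pihomog mdeg i q * p) =
   if (i + d)%N == e then pihomog mdeg i q * p else 0.
  have h := dhomogM (pihomogP mdeg i q) hp; case: eqP => [<-|/eqP ne];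
    first by rewrite pihomog_dE.
  by rewrite (pihomog_ne0 _ h).
rewrite (eq_bigr (fun i : 'I_(mmeasure mdeg q) =>
  if (i + d)%N == e then pihomog mdeg i q * p else 0)); last by move=> i _; apply: H.
case: leqP => de; last first.
  by apply: big1 => i _; case: eqP => // E; move: de; rewrite -E ltnNge leq_addl.
case: (ltnP (e - d) (mmeasure mdeg q)) => lt.
  rewrite (bigD1 (Ordinal lt)) //= subnK // eqxx big1 ?addr0 // => i /eqP ne.
  by case: eqP => // E; case: ne; apply: val_inj; rewrite /= -E addnK.
rewrite big1 => [|i _]; last first.
  by case: eqP => // E; move: lt; rewrite -E addnK leqNgt ltn_ord.
suff -> : pihomog mdeg (e - d) q = 0 by rewrite mul0r.
rewrite pihomogE big_seq_cond big1 // => m /andP[mq /eqP E].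
by have := mmeasure_mnm_lt mdeg mq; rewrite E ltnNge lt.
Qed.

End LinearForms.

(** * Abstract GKM graphs: reduction to flats of rank two *)

Section SeqFacts.

Lemma not_uniq_mem_rem (T : eqType) (l : seq T) : ~~ uniq l ->
  exists2 a, a \in l & a \in rem a l.
Proof.
elim: l => [|b l IH] //=; rewrite negb_and negbK; case: (boolP (b \in l)) => [bl _|bl /= /IH].
  by exists b; rewrite ?mem_head //= eqxx.
case=> a al ar; exists a; first by rewrite inE al orbT.
by case: eqP => [E|_]; [rewrite E al in bl | rewrite inE ar orbT].
Qed.

Lemma mul_prod_sub (R : comPzRingType) (T : eqType) (s l : seq T) (f : T -> R) :
  uniq s -> {subset s <= l} -> exists q, \prod_(a <- l) f a = q * \prod_(a <- s) f a.
Proof.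
elim: s l => [|a s IH] l /=; first by exists (\prod_(a <- l) f a); rewrite big_nil mulr1.
case/andP=> as_ us sub; have al : a \in l by apply: sub; rewrite mem_head.
have [|q Eq] := IH (rem a l) us.
  move=> b bs; have := sub b; rewrite inE bs orbT (perm_mem (perm_to_rem al)) inE => /(_ isT).
  by case: eqP => [E|//]; rewrite -E bs in as_.
by exists q; rewrite (perm_big _ (perm_to_rem al)) !big_cons Eq mulrCA.
Qed.

End SeqFacts.

Section Generic.
Variable F : numFieldType.

(* The moment curve meets each hyperplane finitely often. *)
Lemma generic_vector k (s : seq 'M[F]_k) :
  (forall U, U \in s -> (\rank U < k)%N) ->
  exists v : 'rV[F]_k, forall U, U \in s -> ~~ (v <= U)%MS.
Proof.
move=> rk; pose vt (t : F) : 'rV[F]_k := \row_i t ^+ i.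
suff [p p0 Hp] : exists2 p : {poly F}, p != 0 &
    forall t, ~~ root p t -> forall U, U \in s -> ~~ (vt t <= U)%MS.
  have [t nt] : exists t, ~~ root p t.
    (* The points 0, 1, ..., [size p - 1] are distinct in characteristic 0 and outnumber the roots
       of [p]. *)
    pose rs : seq F := [seq i%:R | i <- iota 0 (size p)].
    have urs : uniq rs by rewrite map_inj_uniq ?iota_uniq // => i j /eqP; rewrite eqr_nat => /eqP.
    have /allPn[t _ nt] : ~~ all (root p) rs; last by exists t.
    by apply/negP => /(max_poly_roots p0)/(_ urs); rewrite size_map size_iota ltnn.
  by exists (vt t); apply: Hp.
elim: s rk => [|U s IH] rk; first by exists 1; rewrite ?oner_eq0.
have [|p p0 Hp] := IH; first by move=> V Vs; apply: rk; rewrite inE Vs orbT.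
have kU : cokermx U != 0.
  rewrite -mxrank_eq0 mxrank_coker -lt0n subn_gt0; apply: rk; exact: mem_head.
have [i [j cij]] : exists i j, cokermx U i j != 0.
  suff /existsP[i /existsP[j cij]] : [exists i, exists j, cokermx U i j != 0] by exists i, j.
  apply: contraNT kU => /existsPn H; apply/eqP/matrixP => i j; rewrite [RHS]mxE.
  by apply/eqP; apply: contraNT (H i) => c; apply/existsP; exists j.
(* A column of the cokernel is a linear form vanishing on [U]; along the moment curve it becomes the
   polynomial [c]. The default 0 is never met, as [l < k]. *)
pose c := \poly_(l < k) (if insub l is Some l' then cokermx U l' j else 0).
have c0 : c != 0.
  apply: contraNneq cij => c0; have := congr1 (fun q : {poly F} => q`_i) c0.
  by rewrite coef_poly coef0 ltn_ord (_ : insub _ = Some i) ?valK // => ->.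
exists (c * p); first by rewrite mulf_neq0.
move=> t; rewrite rootM negb_or => /andP[ct pt] V; rewrite inE => /predU1P[->|]; last exact: Hp.
apply: contraNN ct; rewrite submxE => /eqP E; rewrite /root horner_poly.
have := congr1 (fun M : 'rV_k => M 0 j) E; rewrite [LHS]mxE [RHS]mxE => E'.
rewrite -[X in _ == X]E'; apply/eqP/eq_bigr => l _; rewrite mxE mulrC; congr (_ * _).
by rewrite (_ : insub _ = Some l) ?valK.
Qed.

End Generic.

Section AbstractGKM.
Variable F : numFieldType.

(* [E w] lists the edges entering [w], as pairs (source, label). *)
Definition edges N k := 'I_N -> seq ('I_N * 'rV[F]_k).

Definition wf_edges N k (E : edges N k) :=
  forall w, [/\ forall e, e \in E w -> (e.1 < w)%N /\ e.2 != 0 &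
    pairwise (fun e e' => ~~ (e'.2 <= e.2)%MS) (E w)].

Definition gkm_edges N k (E : edges N k) (P : 'I_N -> {mpoly F[k]}) :=
  forall w e, e \in E w -> dvdmp (lf e.2) (P e.1 - P w).

Definition euler N k (E : edges N k) w : {mpoly F[k]} := \prod_(e <- E w) lf e.2.

(** Vanishing is asked before [x] in the numbering rather than off the vertices reachable from [x];
    this weaker condition passes easily between a graph and its flats. *)
Definition good N k (E : edges N k) := forall x, exists P,
  [/\ gkm_edges E P, P x = euler E x & forall y : 'I_N, (y < x)%N -> P y = 0].

Definition restr N k m (E : edges N k) (U : 'M[F]_(m, k)) : edges N k :=
  fun w => [seq e <- E w | (e.2 <= U)%MS].

Definition map_edges N k m (E : edges N k) (L : 'M[F]_(k, m)) : edges N m :=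
  fun w => [seq (e.1, e.2 *m L) | e <- E w].

Lemma good_map N k m (E : edges N k) (L : 'M[F]_(k, m)) : good E -> good (map_edges E L).
Proof.
move=> gE x; have [P [gP Px Py]] := gE x; exists (fun y => subst L (P y)); split.
- move=> w e /mapP[e' /gP [q Eq]] -> /=; exists (subst L q).
  by rewrite -raddfB /= Eq rmorphM /= subst_lf.
- rewrite Px /euler rmorph_prod /= big_map; apply: eq_bigr => e _; exact: subst_lf.
- by move=> y /Py ->; rewrite rmorph0.
Qed.

Lemma eq_good N k (E E' : edges N k) : E =1 E' -> good E -> good E'.
Proof.
move=> EE gE x; have [P [gP Px Py]] := gE x; exists P; split=> //.
  by move=> w e; rewrite -EE; apply: gP.
by rewrite Px /euler EE.
Qed.

(** * Leading coefficients of classes *)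

Section Reduction.
Variables (N k : nat) (E : edges N k).
Hypotheses (k_gt2 : (2 < k)%N) (wfE : wf_edges E).
Hypothesis flats : forall m (U : 'M[F]_(m, k)), (\rank U < k)%N -> good (restr E U).

Let A := undup (flatten [seq [seq e.2 | e <- E w] | w <- enum 'I_N]).

Lemma label_mem w e : e \in E w -> e.2 \in A.
Proof.
move=> eE; rewrite mem_undup; apply/flatten_mapP; exists w; first by rewrite mem_enum.
exact: map_f.
Qed.

(** For fixed [x] these [g] form an ideal, and [good E] says that it contains 1 for every [x]. *)
Let J x g := exists P,
  [/\ gkm_edges E P, P x = g * euler E x & forall y : 'I_N, (y < x)%N -> P y = 0].

Lemma leadD x f g : J x f -> J x g -> J x (f + g).
Proof.
case=> P [gP Px Py] [Q [gQ Qx Qy]]; exists (fun w => P w + Q w); split.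
- by move=> w e eE; rewrite opprD addrACA; apply: dvdmpD; [apply: gP|apply: gQ].
- by rewrite Px Qx mulrDl.
- by move=> y yx; rewrite Py // Qy // addr0.
Qed.

Lemma leadM x f g : J x g -> J x (f * g).
Proof.
case=> P [gP Px Py]; exists (fun w => f * P w); split.
- by move=> w e eE; rewrite -mulrBr; apply/dvdmp_mull/gP.
- by rewrite Px mulrA.
- by move=> y yx; rewrite Py // mulr0.
Qed.

Lemma lead0 x : J x 0.
Proof. by exists (fun=> 0); split=> //; rewrite ?mul0r // => w e _; rewrite subrr;
  apply: dvdmp0. Qed.

Lemma lead_sum x I (r : seq I) (f : I -> {mpoly F[k]}) :
  (forall i, J x (f i)) -> J x (\sum_(i <- r) f i).
Proof.
move=> H; elim: r => [|i r IH]; first by rewrite big_nil; apply: lead0.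
by rewrite big_cons; apply: leadD.
Qed.

(** A class for the flat keeps its divisibility along edges with label in [U]; every other edge has
    its label among the factors of [G]. *)
Lemma lead_flat x m (U : 'M[F]_(m, k)) : (\rank U < k)%N ->
  J x (\prod_(a <- A | ~~ (a <= U)%MS) lf a).
Proof.
move=> rU; have [P [gP Px Py]] := flats rU x; set G := \prod_(a <- A | _) _.
(* The second product completes the Euler product of the flat at [x] to that of [E]. *)
exists (fun w => G * \prod_(e <- E x | ~~ (e.2 <= U)%MS) lf e.2 * P w); split.
- move=> w e eE; rewrite -mulrBr; case: (boolP (e.2 <= U)%MS) => eU.
    by apply/dvdmp_mull/gP; rewrite mem_filter eU.
  apply/dvdmp_mulr/dvdmp_mulr; rewrite /G -big_filter.
  have eA : e.2 \in [seq a <- A | ~~ (a <= U)%MS] by rewrite mem_filter eU (label_mem eE).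
  by rewrite (big_rem _ eA) /=; apply/dvdmp_mulr/dvdmp_refl.
- rewrite Px /euler /restr big_filter -mulrA; congr (_ * _).
  by rewrite [RHS](bigID (fun e => (e.2 <= U)%MS)) /= mulrC.
- by move=> y /Py ->; rewrite mulr0.
Qed.

Definition mx_of (s : seq 'rV[F]_k) : 'M[F]_(size s, k) := \matrix_i nth 0 s i.

Lemma mem_mx_of s a : a \in s -> (a <= mx_of s)%MS.
Proof.
move=> as_; have lt : (index a s < size s)%N by rewrite index_mem.
by rewrite -(nth_index 0 as_) -(rowK (fun i : 'I__ => nth 0 s i) (Ordinal lt)) row_sub.
Qed.

(* Straightening: if a factor a is repeated, expand one copy over the labels that do
   not occur; this is possible unless those lie in a proper subspace U. *)
Lemma lead_prod_labels x l : {subset l <= A} -> (size A < size l)%N ->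
  J x (\prod_(a <- l) lf a).
Proof.
have [n] := ubnP (size A - size (undup l)); elim: n l => // n IH l le lA sl.
set B := [seq a <- A | a \notin l].
(* If the labels missing from [l] do not span, every label outside their span occurs in [l], and
   [lead_flat] provides a divisor of the product. *)
have [rB|] := ltnP (\rank (mx_of B)) k.
  have [||q ->] := @mul_prod_sub _ _ [seq a <- A | ~~ (a <= mx_of B)%MS] l (@lf F k).
  - by rewrite filter_uniq // undup_uniq.
  - move=> a; rewrite mem_filter => /andP[aB aA]; apply: contraNT aB => al.
    by apply: mem_mx_of; rewrite mem_filter al.
  by rewrite big_filter; apply/leadM/lead_flat.
move=> rB; have fB : row_full (mx_of B) by rewrite /row_full eqn_leq rank_leq_col.
have [a al ar] : exists2 a, a \in l & a \in rem a l.
  apply: not_uniq_mem_rem; apply: contraTN sl => ul.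
  by rewrite -leqNgt uniq_leq_size.
have [D aE] := submxP (submx_full a fB).
rewrite (perm_big _ (perm_to_rem al)) big_cons /= [in lf a]aE mulmx_sum_row linear_sum mulr_suml.
apply: lead_sum => i; rewrite linearZ /= -scalerAl -mul_mpolyC; apply: leadM; rewrite rowK.
set b := nth 0 B i; have bB : b \in B by apply: mem_nth.
move: bB; rewrite mem_filter => /andP[bl bA].
have brem : b \notin rem a l by apply: contraNN bl; apply: mem_rem.
have srem : size (rem a l) = (size l).-1 by apply: size_rem.
have -> : lf b * \prod_(c <- rem a l) lf c = \prod_(c <- b :: rem a l) lf c by rewrite big_cons.
(* The new list gains the label [b] and still holds a copy of [a], so fewer labels are missing. *)
apply: IH.
- rewrite /= (negPf brem) /=.
  have -> : size (undup (rem a l)) = size (undup l).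
    apply/perm_size/uniq_perm; rewrite ?undup_uniq // => c; rewrite !mem_undup.
    apply/idP/idP => [/mem_rem //|]; rewrite (perm_mem (perm_to_rem al)) inE.
    by case/predU1P => [->|].
  have lt : (size (b :: undup l) <= size A)%N.
    apply: uniq_leq_size; first by rewrite /= mem_undup bl undup_uniq.
    by move=> c; rewrite inE mem_undup => /predU1P[->|/lA].
  by rewrite -ltnS (leq_trans _ le) // ltnS subnS prednK // subn_gt0.
- by move=> c; rewrite inE => /predU1P[->//|/mem_rem/lA].
- by rewrite /= srem prednK //; case: (l) al.
Qed.

(** Each factor from [l1] is expanded over the labels and moved into [l2], until [lead_prod_labels]
    applies. *)
Lemma lead_prod x l1 l2 : {subset l2 <= A} -> (size A < size l1 + size l2)%N ->
  J x (\prod_(a <- l1) lf a * \prod_(a <- l2) lf a).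
Proof.
have [rA|] := ltnP (\rank (mx_of A)) k.
  (* If the labels do not span, their span is a proper flat that leaves out none of them, and
     already 1 is a leading coefficient. *)
  move=> _ _; rewrite -[_ * _]mulr1; apply: leadM; have := lead_flat x rA.
  by rewrite big_seq_cond big_pred0 // => a; case: (boolP (a \in A)) => //= /mem_mx_of ->.
move=> rA; have fA : row_full (mx_of A) by rewrite /row_full eqn_leq rank_leq_col.
elim: l1 l2 => [|v l1 IH] l2 l2A; first by rewrite big_nil mul1r; apply: lead_prod_labels.
move=> sl; have [D vE] := submxP (submx_full v fA).
rewrite big_cons [in lf v]vE mulmx_sum_row linear_sum !mulr_suml.
apply: lead_sum => i; rewrite linearZ /= -!scalerAl -mul_mpolyC; apply: leadM; rewrite rowK.
set b := nth 0 A i; rewrite mulrAC mulrC.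
have -> : lf b * \prod_(c <- l2) lf c = \prod_(c <- b :: l2) lf c by rewrite big_cons.
apply: IH; last by rewrite /= addnS.
by move=> c; rewrite inE => /predU1P[->|/l2A //]; apply: mem_nth.
Qed.

Lemma monomial_prod_lf (m : 'X_{1..k}) :
  exists2 l : seq 'rV[F]_k, size l = mdeg m & 'X_[m] = \prod_(a <- l) lf a.
Proof.
rewrite mpolyXE_id mdegE; elim/big_rec2: _ => [|i n p _ [l sl ->]].
  by exists [::]; rewrite ?big_nil.
exists (nseq (m i) (delta_mx 0 i) ++ l); first by rewrite size_cat size_nseq sl.
by rewrite big_cat big_nseq /= lf_delta iter_mulr_1.
Qed.

Lemma lead_homog x g d : (size A < d)%N -> g \is d.-homog -> J x g.
Proof.
move=> Ad /dhomogP hg; rewrite [g]mpolyE big_seq; rewrite -big_filter.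
rewrite (_ : [seq m <- _ | _] = msupp g); last by apply/all_filterP/allP.
rewrite big_seq; elim/big_rec: _ => [|m p mg IH]; first exact: lead0.
apply: leadD => //; rewrite -mul_mpolyC; apply: leadM.
have [l sl ->] := monomial_prod_lf m; rewrite -[\prod_(_ <- _) _]mulr1.
rewrite -[X in _ * X](big_nil 1 *%R predT (@lf F k)); apply: lead_prod => //.
by rewrite addn0 sl (hg _ mg).
Qed.

(** Here [d] is the degree of the class, so [g] has degree [d - size (E x)]; the inequality guards
    the truncated subtraction. *)
Let full d := forall x g, (size (E x) <= d)%N -> g \is (d - size (E x)).-homog ->
  exists P, [/\ gkm_edges E P, P x = g * euler E x,
    forall y : 'I_N, (y < x)%N -> P y = 0 & forall y, P y \is d.-homog].

Lemma euler_homog x : euler E x \is (size (E x)).-homog.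
Proof. exact: prod_lf_homog. Qed.

Lemma gkm_pihomog d P : gkm_edges E P -> gkm_edges E (fun w => pihomog mdeg d (P w)).
Proof.
move=> gP w e /gP[q Eq]; rewrite -raddfB /= Eq (pihomog_mulr _ _ (lf_homog _)).
by case: ifP => _; [exists (pihomog mdeg (d - 1) q) | apply: dvdmp0].
Qed.

Lemma full_large d : (size A + \max_(w < N) size (E w) < d)%N -> full d.
Proof.
move=> ld x g sx hg; have mx : (size (E x) <= \max_(w < N) size (E w))%N.
  exact: leq_bigmax.
have [|P [gP Px Py]] := lead_homog x _ hg.
  by rewrite ltn_subRL (leq_ltn_trans _ ld) // addnC leq_add2l.
exists (fun w => pihomog mdeg d (P w)); split.
- exact: gkm_pihomog.
- rewrite Px pihomog_dE // -(subnK sx); apply: dhomogM hg _; exact: euler_homog.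
- by move=> y /Py ->; rewrite pihomog0.
- by move=> y; apply: pihomogP.
Qed.

Let rank_pair (a b : 'rV[F]_k) : (\rank <<col_mx a b>>%MS < k)%N.
Proof. by rewrite mxrank_gen (leq_ltn_trans _ k_gt2) // rank_leq_row. Qed.

Lemma generic_form : exists2 l : 'rV[F]_k, l != 0 &
  forall a b, a \in A -> b \in A -> ~~ (l <= col_mx a b)%MS.
Proof.
(* The extra subspace 0 forces [l] to be nonzero. *)
have [|l Hl] := @generic_vector F k (0 :: [seq <<col_mx a b>>%MS | a <- A, b <- A]).
  move=> U; rewrite inE => /predU1P[->|/allpairsP[[a b] [_ _ ->]]]; last exact: rank_pair.
  by rewrite mxrank0 (leq_trans _ k_gt2).
exists l => [|a b aA bA].
  by apply: contraTneq (Hl 0 (mem_head _ _)) => ->; rewrite sub0mx.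
have := Hl <<col_mx a b>>%MS; rewrite genmxE; apply; rewrite inE; apply/orP; right.
exact: (allpairs_f (fun a b : 'rV_k => <<col_mx a b>>%MS)).
Qed.

(** * Descent in degree along a generic form *)

Section Descent.
Variable l : 'rV[F]_k.
Hypothesis l_gen : forall a b, a \in A -> b \in A -> ~~ (l <= col_mx a b)%MS.

(** The vector [b - c *: a] lies on the line of [l]; were it nonzero, [l] would lie in the span of
    [a] and [b]. *)
Lemma proj_sub (a b : 'rV[F]_k) : l != 0 -> (b *m proj l <= a *m proj l)%MS ->
  ~~ (l <= col_mx a b)%MS -> (b <= a)%MS.
Proof.
move=> l0 /sub_rVP[c Ec] nl; pose u := b - c *: a.
have /proj_eq0/sub_rVP[t Et] : u *m proj l = 0.
  by rewrite mulmxBl Ec -scalemxAl subrr.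
have uab : (u <= col_mx a b)%MS.
  rewrite /u addmx_sub ?eqmx_opp ?scalemx_sub // -addsmxE; [exact: addsmxSr | exact: addsmxSl].
have [t0|t0] := eqVneq t 0.
  by apply/sub_rVP; exists c; apply/eqP; rewrite -subr_eq0 -/u Et t0 scale0r.
case/negP: nl; have -> : l = t^-1 *: u by rewrite Et scalerA mulVf // scale1r.
exact: scalemx_sub.
Qed.

(* Modulo l the incoming labels stay pairwise independent, so a value lying in
   every ideal (l, a) lies in (l, euler E y). *)
Lemma mod_generic y f : l != 0 ->
  (forall e, e \in E y -> exists g, dvdmp (lf e.2) (g - f) /\ dvdmp (lf l) g) ->
  exists r, dvdmp (lf l) (f - r * euler E y).
Proof.
move=> l0 H; have [Hy pw] := wfE y.
have [||| r Er] := @prod_lf_dvd F k [seq e.2 *m proj l | e <- E y] (subst (proj l) f).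
- apply/allP => _ /mapP[e eE ->]; have [_ e0] := Hy e eE; have eA := label_mem eE.
  apply: contraNneq (l_gen eA eA) => /proj_eq0/sub_rVP[t Et].
  have t0 : t != 0 by apply: contraNneq e0 => t0; rewrite Et t0 scale0r.
  have -> : l = t^-1 *: e.2 by rewrite Et scalerA mulVf // scale1r.
  by apply: scalemx_sub; rewrite -addsmxE; apply: addsmxSl.
- rewrite pairwise_map; apply: sub_in_pairwise (allss _) pw => e e' eE e'E /=.
  by apply: contraNN => /(proj_sub l0); apply; apply: l_gen;
    [apply: (label_mem eE) | apply: (label_mem e'E)].
- move=> _ /mapP[e eE ->]; have [g [[q Eq] /(dvd_lfP _ l0) g0]] := H e eE.
  exists (- subst (proj l) q); rewrite mulNr -subst_lf -rmorphM -Eq rmorphB /= g0.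
  by rewrite sub0r opprK.
have Ee : \prod_(a <- [seq e.2 *m proj l | e <- E y]) lf a = subst (proj l) (euler E y).
  by rewrite big_map rmorph_prod; apply: eq_bigr => e _; rewrite /= subst_lf.
exists r; apply/(dvd_lfP _ l0); rewrite rmorphB rmorphM /= -Ee.
have /(dvd_lfP _ l0) := subst_proj_mod l f; rewrite rmorphB => /eqP.
rewrite subr_eq0 => /eqP ->; rewrite Er rmorphM /= Ee.
have /(dvd_lfP _ l0) := subst_proj_mod l (euler E y); rewrite rmorphB => /eqP.
by rewrite subr_eq0 => /eqP <-; rewrite subrr.
Qed.

(** The component of degree [d.+1] of the congruence is taken; the Euler term disappears when
    [size (E y)] exceeds [d.+1], and then [f] itself is divisible. *)
Lemma mod_generic_homog d y f : l != 0 -> f \is d.+1.-homog ->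
  (forall e, e \in E y -> exists g, dvdmp (lf e.2) (g - f) /\ dvdmp (lf l) g) ->
  dvdmp (lf l) f \/ (size (E y) <= d.+1)%N /\ exists2 r,
    r \is (d.+1 - size (E y)).-homog & dvdmp (lf l) (f - r * euler E y).
Proof.
move=> l0 hf /(mod_generic l0)[r [q Eq]].
have := congr1 (pihomog mdeg d.+1) Eq; rewrite raddfB /= pihomog_dE //.
rewrite !(pihomog_mulr _ _ (lf_homog _)) (pihomog_mulr _ _ (euler_homog _)) /=.
case: leqP => [le|_] E'; [right|left].
- by split=> //; exists (pihomog mdeg (d.+1 - size (E y)) r); [apply: pihomogP | eexists;
  apply: E'].
- by eexists; rewrite -[LHS]subr0; apply: E'.
Qed.

Lemma descent d : l != 0 -> full d.+1 -> full d.
Proof.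
move=> l0 Hd x g sx hg.
(* Vertices are treated in increasing order, the first [n] having values divisible by [lf l].
   Corrections start at vertices after [x], so the value at [x] is kept. *)
have main : forall n, (n <= N)%N -> exists P, [/\ gkm_edges E P,
    P x = lf l * g * euler E x, forall y : 'I_N, (y < x)%N -> P y = 0,
    forall y, P y \is d.+1.-homog & forall y : 'I_N, (y < n)%N -> dvdmp (lf l) (P y)].
  elim=> [_|n IH ltn].
    have [||P [gP Px Py hP]] := Hd x (lf l * g); last by exists P.
    - exact: leqW.
    - by rewrite subSn // -add1n; apply: dhomogM hg; apply: lf_homog.
  have [P [gP Px Py hP dP]] := IH (ltnW ltn); pose y := Ordinal ltn.
  have step : dvdmp (lf l) (P y) -> exists P, [/\ gkm_edges E P,
    P x = lf l * g * euler E x, forall y : 'I_N, (y < x)%N -> P y = 0,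
    forall y, P y \is d.+1.-homog & forall y : 'I_N, (y < n.+1)%N -> dvdmp (lf l) (P y)].
    move=> dy; exists P; split=> // z; rewrite ltnS leq_eqVlt => /predU1P[zn|]; last exact: dP.
    by have -> : z = y by apply: val_inj.
  have [yx|xy|yx] := ltngtP y x.
  - by apply: step; rewrite Py //; apply: dvdmp0.
  (* Sources of edges into [y] precede [y], so their values are already divisible by [lf l]. *)
  - have [e eE|/step //|[sy [r hr dr]]] := @mod_generic_homog d y _ l0 (hP y).
      by exists (P e.1); split; [exact: gP | apply: dP; have [/(_ e eE)[]] := wfE y].
    have [Q [gQ Qy Q0 hQ]] := Hd y r sy hr.
    exists (fun z => P z - Q z); split.
    + move=> w e eE; have -> : P e.1 - Q e.1 - (P w - Q w) = (P e.1 - P w) - (Q e.1 - Q w).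
        by rewrite !opprB addrACA [RHS]addrACA; congr (_ + _); rewrite addrC.
      by apply: dvdmpB; [apply: gP | apply: gQ].
    + by rewrite Px (Q0 x xy) subr0.
    + by move=> z zx; rewrite Py // Q0 ?subr0 // (ltn_trans zx).
    + by move=> z; apply: rpredB.
    + move=> z; rewrite ltnS leq_eqVlt => /predU1P[zn|zn]; last by rewrite Q0 // subr0; apply: dP.
      by have -> : z = y by [apply: val_inj]; rewrite Qy.
  - by apply: step; have -> : y = x by [apply: val_inj]; rewrite Px -mulrA mulrC; eexists.
have [P [gP Px Py hP dP]] := main N (leqnn N).
have [Q EQ] : exists Q : {ffun 'I_N -> {mpoly F[k]}}, forall y, P y = Q y * lf l.
  have /fin_all_exists[Q EQ] : forall y, exists q, P y = q * lf l by move=> y; apply: dP.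
  by exists [ffun y => Q y] => y; rewrite ffunE.
have ll0 : lf l != 0 by rewrite lf_eq0.
exists Q; split.
- move=> w e eE; have := gP w e eE; rewrite !EQ -mulrBl.
  have [_ e0] : (e.1 < w)%N /\ e.2 != 0 by have [H _] := wfE w; apply: H.
  (* Division by [lf l] keeps the edge conditions because no label is proportional to [l]. *)
  case/(lf_prime e0) => // /(dvd_lf_lf e0) le; have eA := label_mem eE.
  by case/negP: (l_gen eA eA); apply: submx_trans le _; rewrite -addsmxE; apply: addsmxSl.
- by apply: (mulIf ll0); rewrite -EQ Px -mulrA mulrC.
- by move=> y /Py; rewrite EQ => /eqP; rewrite mulf_eq0 (negPf ll0) orbF => /eqP.
- move=> y; have := hP y; rewrite EQ homog_piE (pihomog_mulr _ _ (lf_homog _)) /= subn1 /=.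
  by move=> /eqP/(mulIf ll0) <-; apply: pihomogP.
Qed.

End Descent.

Lemma good_of_flats : good E.
Proof.
have [l l0 Hl] := generic_form; move=> x.
have fullE d : full d.
  (* Descending induction on [d], starting from the range of [full_large]. *)
  have [n] := ubnP (size A + \max_(w < N) size (E w) + 1 - d); elim: n d => // n IH d le.
  have [lt|ge] := ltnP (size A + \max_(w < N) size (E w)) d; first exact: full_large.
  apply: (descent Hl l0); apply: IH; rewrite -ltnS (leq_trans _ le) // ltnS.
  by rewrite subnS prednK // subn_gt0 addn1 ltnS.
have [|P [gP Px Py _]] := fullE (size (E x)) x 1 (leqnn _).
  by rewrite subnn dhomog1.
by exists P; split; rewrite // Px mul1r.
Qed.

End Reduction.

Lemma restr_all N k (E : edges N k) m (U : 'M[F]_(m, k)) : row_full U -> E =1 restr E U.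
Proof. by move=> fU w; symmetry; apply/all_filterP/allP => e _; apply: submx_full. Qed.

Lemma wf_restr N k (E : edges N k) m (U : 'M[F]_(m, k)) : wf_edges E -> wf_edges (restr E U).
Proof.
move=> wE w; have [H pw] := wE w; split=> [e|].
  by rewrite mem_filter => /andP[_ /H].
by apply: subseq_pairwise pw; apply: filter_subseq.
Qed.

(** Induction on the number of variables: a proper flat [U], written in coordinates along a basis of
    [U], is a graph with labels in [\rank U] variables. *)
Theorem good_of_rank2_flats N k (E : edges N k) : wf_edges E ->
  (forall m (U : 'M[F]_(m, k)), (\rank U <= 2)%N -> good (restr E U)) -> good E.
Proof.
have [n] := ubnP k; elim: n k E => // n IH k E lek wE H2.
have [k2|k2] := leqP k 2.
  by apply: (@eq_good _ _ (restr E 1%:M)); [move=> w;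
    rewrite -(restr_all E) // row_full_unit unitmx1
     | apply: H2; rewrite mxrank1].
apply: good_of_flats => // m U rU; pose B := row_base U; pose L := pinvmx B.
have fB : row_free B by apply: row_base_free.
have BU a : (a <= U)%MS -> a *m L *m B = a by move=> aU; rewrite mulmxKpV // eq_row_base.
have EB : map_edges (map_edges (restr E U) L) B =1 restr E U.
  move=> w; rewrite /map_edges -map_comp -[RHS]map_id; apply/eq_in_map => e.
  by rewrite mem_filter => /andP[eU _]; case: e eU => u a /= aU; rewrite BU.
apply: (eq_good EB); apply: good_map; apply: IH.
- exact: leq_trans rU lek.
- move=> w; have [H pw] := wf_restr U wE w; split=> [e /mapP[e' e'E ->] /=|].
    have [lt e0] := H _ e'E; split=> //; apply: contraNneq e0 => e0.
    by move: e'E; rewrite mem_filter => /andP[/BU <- _]; rewrite e0 mul0mx.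
  rewrite pairwise_map; apply: sub_in_pairwise (allss _) pw => e e'.
  rewrite !mem_filter => /andP[eU _] /andP[e'U _] /=; apply: contraNN => /(submxMr B).
  by rewrite !BU.
(* A flat [U'] in the new coordinates is the flat [U' *m B] in the old ones, and its rank does not
   grow. *)
- move=> m' U' rU'; apply: (@eq_good _ _ (map_edges (restr E (U' *m B)) L)); last first.
    by apply/good_map/H2; apply: leq_trans (mxrankM_maxl _ _) rU'.
  move=> w; rewrite /restr /map_edges filter_map -filter_predI; congr map.
  apply: eq_filter => e /=; apply/idP/andP => [eUB|[eU' eU]].
    have eU : (e.2 <= U)%MS.
      by rewrite (submx_trans eUB) // (submx_trans (submxMl _ _)) // eq_row_base.
    split=> //; rewrite -(mulmxKp fB U'); exact: submxMr.
  by rewrite -(BU _ _ eU); apply: submxMr.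
Qed.

End AbstractGKM.

(** * Root systems *)

Section InnerProduct.
Variables (n : nat) (B : 'M[R]_n).
Hypothesis pB : sym_posdef B.
Local Notation vec := 'rV[R]_n.
Local Notation ip := (Defs.form B).

Lemma ipC u v : ip u v = ip v u.
Proof.
have [sB _] := pB; rewrite /Defs.form -[in LHS]sB -[in RHS]sB.
have -> : (v *m B^T *m u^T) = (u *m B *m v^T)^T by rewrite !trmx_mul trmxK mulmxA.
by rewrite sB [RHS]mxE.
Qed.

Lemma ipDl u v w : ip (u + v) w = ip u w + ip v w.
Proof. by rewrite /Defs.form !mulmxDl mxE. Qed.

Lemma ipZl c u v : ip (c *: u) v = c * ip u v.
Proof. by rewrite /Defs.form -!scalemxAl mxE. Qed.

Lemma ipNl u v : ip (- u) v = - ip u v.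
Proof. by rewrite -scaleN1r ipZl mulN1r. Qed.

Lemma ipDr u v w : ip w (u + v) = ip w u + ip w v.
Proof. by rewrite ipC ipDl !(ipC w). Qed.

Lemma ipZr c u v : ip u (c *: v) = c * ip u v.
Proof. by rewrite ipC ipZl ipC. Qed.

Lemma ipNr u v : ip u (- v) = - ip u v.
Proof. by rewrite ipC ipNl ipC. Qed.

Lemma ip0l u : ip 0 u = 0.
Proof. by rewrite -(scale0r 0) ipZl mul0r. Qed.

Lemma ip_gt0 u : u != 0 -> 0 < ip u u.
Proof. by have [_] := pB; apply. Qed.

Lemma reflE a v : v *m refl B a = v - (2 * ip v a / ip a a) *: a.
Proof.
rewrite /refl mulmxBr mulmx1 -scalemxAr; congr (_ - _).
rewrite !mulmxA [v *m B *m a^T]mx11_scalar mul_scalar_mx scalerA -/(Defs.form B v a).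
by rewrite mulrAC.
Qed.

Lemma mulmx_ext m (M N : 'M[R]_(n, m)) : (forall v : vec, v *m M = v *m N) -> M = N.
Proof. by move=> H; apply/row_matrixP => i; rewrite !rowE. Qed.

Lemma refl_self a : a != 0 -> a *m refl B a = - a.
Proof.
move=> a0; have := ip_gt0 a0 => pa; rewrite reflE -mulrA divff ?gt_eqF // mulr1 scaler_nat mulr2n.
by rewrite opprD addNKr.
Qed.

Lemma ip_refl a u v : a != 0 -> ip (u *m refl B a) (v *m refl B a) = ip u v.
Proof.
move=> a0; have pa := ip_gt0 a0; rewrite !reflE.
rewrite !(ipDl, ipDr, ipNl, ipNr, ipZl, ipZr) (ipC a v); field.
by rewrite gt_eqF.
Qed.

Lemma reflK a : a != 0 -> refl B a *m refl B a = 1%:M.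
Proof.
move=> a0; apply: mulmx_ext => v; rewrite mulmxA mulmx1 [v *m _]reflE mulmxBl -scalemxAl
  refl_self //.
by rewrite reflE scalerN opprK subrK.
Qed.

Lemma refl_conj (w : 'M[R]_n) b : (forall u v, ip (u *m w) (v *m w) = ip u v) ->
  refl B b *m w = w *m refl B (b *m w).
Proof.
move=> iw; apply: mulmx_ext => v; rewrite !mulmxA !reflE !iw mulmxBl.
by rewrite -scalemxAl.
Qed.

End InnerProduct.

Section Roots.
Variables (n k : nat) (B : 'M[R]_n) (Phi : seq 'rV[R]_n) (D : 'M[R]_(k, n)).
Hypotheses (pB : sym_posdef B) (rs : root_system B Phi) (bs : is_base Phi D).
Local Notation vec := 'rV[R]_n.
Local Notation ip := (Defs.form B).
Local Notation s_ a := (refl B a).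
Local Notation coord := Defs.coord.
Local Notation pos := (posroots Phi D).
Local Notation W := (weyl B D).

Lemma root_neq0 a : a \in Phi -> a != 0.
Proof. by have [[_ z _] _] := rs => aP; apply: contraNneq z => <-. Qed.

Lemma root_refl a b : a \in Phi -> b \in Phi -> b *m s_ a \in Phi.
Proof. by have [_ [_ H _]] := rs; apply: H. Qed.

Lemma root_opp a : a \in Phi -> - a \in Phi.
Proof. by move=> aP; rewrite -(refl_self pB (root_neq0 aP)) root_refl. Qed.

Lemma root_scale a c : a \in Phi -> c *: a \in Phi -> c = 1 \/ c = -1.
Proof. by have [_ [H _ _]] := rs; apply: H. Qed.

Lemma root_int a b : a \in Phi -> b \in Phi -> exists z : int, 2 * ip b a / ip a a = z%:~R.
Proof. by have [_ [_ _ H]] := rs; apply: H. Qed.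

Lemma simple_root i : simple D i \in Phi.
Proof. by have [H _ _] := bs. Qed.

Lemma coord_is_linear : linear (coord D).
Proof. by move=> c u v; rewrite /coord mulmxDl -scalemxAl. Qed.

Lemma coord_lin c u v i : coord D (c *: u + v) 0 i = c * coord D u 0 i + coord D v 0 i.
Proof. by rewrite coord_is_linear mxE [X in X + _]mxE. Qed.

Lemma coord_comb (c : 'I_k -> R) i : coord D (\sum_j c j *: simple D j) 0 i = c i.
Proof.
have [_ fD _] := bs; rewrite /coord.
have -> : \sum_j c j *: simple D j = (\row_j c j) *m D.
  by rewrite mulmx_sum_row; apply: eq_bigr => j _; rewrite mxE.
by rewrite mulmxKp // mxE.
Qed.

Lemma sub_base (v : vec) : (v <= D)%MS.
Proof.
have [[_ _ sp] _] := rs; have [_ _ H] := bs; have [c ->] := sp v.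
rewrite big_seq; apply: summx_sub => a aP; apply: scalemx_sub; have [z [-> _]] := H a aP.
by apply: summx_sub => i _; apply/scalemx_sub/row_sub.
Qed.

Lemma coordK (v : vec) : coord D v *m D = v.
Proof. by rewrite mulmxKpV // sub_base. Qed.

Lemma coord_inj : injective (coord D).
Proof. by move=> u v E; rewrite -(coordK u) E coordK. Qed.

Lemma linE v : lin D v = lf (coord D v).
Proof. by []. Qed.

Lemma lin_is_linear : linear (lin D).
Proof. by move=> c u v; rewrite !linE coord_is_linear linearP. Qed.
HB.instance Definition _ := GRing.isLinear.Build R vec {mpoly R[k]} _ (lin D) lin_is_linear.

Lemma coord0 : coord D 0 = 0.
Proof. by rewrite /coord mul0mx. Qed.

Lemma coord_eq0 v : (coord D v == 0) = (v == 0).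
Proof. by rewrite -{1}coord0 (inj_eq coord_inj). Qed.

Lemma lin_eq0 v : (lin D v == 0) = (v == 0).
Proof. by rewrite linE lf_eq0 coord_eq0. Qed.

Lemma sub_coord (u v : vec) : (coord D u <= coord D v)%MS -> (u <= v)%MS.
Proof. by move/(submxMr D); rewrite !coordK. Qed.

Lemma lin_prime a f g : a != 0 ->
  dvdmp (lin D a) (f * g) -> dvdmp (lin D a) f \/ dvdmp (lin D a) g.
Proof. by move=> a0; apply: lf_prime; rewrite coord_eq0. Qed.

Lemma dvd_lin_lin (a b : vec) : a != 0 -> dvdmp (lin D a) (lin D b) -> (b <= a)%MS.
Proof. by move=> a0 /dvd_lf_lf H; apply: sub_coord; apply: H; rewrite coord_eq0. Qed.

(** The height of roots, extended linearly to all vectors; its sign tells positive roots from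
    negative ones. *)
Definition theta (v : vec) : R := \sum_i coord D v 0 i.

Lemma theta_is_linear : linear_for *%R theta.
Proof.
move=> c u v; rewrite /theta mulr_sumr -big_split; apply: eq_bigr => i _.
by rewrite coord_is_linear !mxE.
Qed.
HB.instance Definition _ := GRing.isLinear.Build R vec R *%R theta theta_is_linear.

Lemma posP a : reflect (a \in Phi /\ forall i, 0 <= coord D a 0 i) (a \in pos).
Proof.
rewrite mem_filter; apply: (iffP andP) => [[/forallP H aP]|[aP H]]; split=> //.
exact/forallP.
Qed.

Lemma pos_root a : a \in pos -> a \in Phi.
Proof. by case/posP. Qed.

Lemma pos_uniq : uniq pos.
Proof. by have [[u _ _] _] := rs; apply: filter_uniq. Qed.

Lemma theta_pos a : a \in pos -> 0 < theta a.
Proof.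
case/posP => aP H; rewrite lt_def sumr_ge0 ?andbT //.
apply: contra (root_neq0 aP) => /eqP E; rewrite -coord_eq0; apply/eqP/rowP => i; rewrite [RHS]mxE.
exact: (@psumr_eq0P _ _ xpredT (fun j => coord D a 0 j) (fun j _ => H j) E i isT).
Qed.

Lemma root_coord a : a \in Phi -> exists c : 'I_k -> int,
  (forall i, coord D a 0 i = (c i)%:~R) /\ ((forall i, 0 <= c i) \/ (forall i, c i <= 0)).
Proof.
by have [_ _ H] := bs => /H[c [-> Hc]]; exists c; split=> // i; rewrite coord_comb.
Qed.

Lemma root_pos a : a \in Phi -> 0 < theta a -> a \in pos.
Proof.
move=> aP ta; apply/posP; split=> // i; have [c [Ec [Hc|Hc]]] := root_coord aP.
  by rewrite Ec ler0z.
suff : theta a <= 0 by rewrite leNgt ta.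
by apply: sumr_le0 => j _; rewrite Ec lerz0.
Qed.

Lemma posE a : (a \in pos) = (a \in Phi) && (0 < theta a).
Proof.
by apply/idP/andP => [aP|[]]; [rewrite pos_root ?theta_pos | exact: root_pos].
Qed.

Lemma root_sign a : a \in Phi -> a \in pos \/ - a \in pos.
Proof.
move=> aP; have [c [Ec Hc]] := root_coord aP; case: Hc => Hc; [left|right]; apply/posP;
  split=> //.
- by move=> i; rewrite Ec ler0z.
- exact: root_opp.
- by move=> i; rewrite /coord mulNmx mxE -/(coord D a) Ec oppr_ge0 lerz0.
Qed.

Lemma theta_neq0 a : a \in Phi -> theta a != 0.
Proof.
move=> /root_sign[/theta_pos|/theta_pos]; first by rewrite lt_def => /andP[].
by rewrite linearN /= oppr_gt0 lt_def eq_sym => /andP[].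
Qed.

Lemma pos_height a : a \in pos -> exists m : nat, theta a = m%:R.
Proof.
move=> aP; have [c [Ec _]] := root_coord (pos_root aP).
have [_ Hp] := posP _ aP; exists (\sum_i absz (c i))%N.
rewrite natr_sum; apply: eq_bigr => i _; have := Hp i; rewrite Ec ler0z => ci.
by rewrite -{1}(gez0_abs ci) pmulrn.
Qed.

(* Cauchy-Schwarz makes the product of the two Cartan integers less than 4. *)
Lemma root_sub a b : a \in Phi -> b \in Phi -> 0 < ip a b -> a != b -> a - b \in Phi.
Proof.
move=> aP bP pab ab.
have pa := ip_gt0 pB (root_neq0 aP); have pb := ip_gt0 pB (root_neq0 bP).
have [z1 E1] := root_int aP bP; have [z2 E2] := root_int bP aP.
have z1p : 0 < z1 by rewrite -(ltr0z R) -E1 divr_gt0 // mulr_gt0 // ipC.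
have z2p : 0 < z2 by rewrite -(ltr0z R) -E2 divr_gt0 // mulr_gt0.
have lt4 : z1 * z2 < 4.
  pose t := ip a b / ip b b; have u0 : a - t *: b != 0.
    apply: contra ab; rewrite subr_eq0 => /eqP Ea.
    have [t1|t1] : t = 1 \/ t = -1 by apply: (root_scale bP); rewrite -Ea.
      by rewrite Ea t1 scale1r.
    have : 0 < t by rewrite divr_gt0.
    by rewrite t1 oppr_gt0 ltr10.
  have : 0 < ip a a - ip a b ^+ 2 / ip b b.
    have -> : ip a a - ip a b ^+ 2 / ip b b = ip (a - t *: b) (a - t *: b); last exact: ip_gt0.
    rewrite !(ipDl, ipDr, ipNl, ipNr, ipZl, ipZr) // (ipC pB b a) /t; field.
    by rewrite gt_eqF.
  rewrite subr_gt0 ltr_pdivrMr // => cs.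
  rewrite -(ltr_int R) intrM -E1 -E2 (ipC pB b a).
  have -> : 2 * ip a b / ip a a * (2 * ip a b / ip b b) = 4 * (ip a b ^+ 2 / (ip a a * ip b b)).
    by field; rewrite !gt_eqF.
  by rewrite -[X in _ < X]mulr1 ltr_pM2l // ltr_pdivrMr ?mul1r // mulr_gt0.
(* Two positive integers with product below 4 include a 1, and the corresponding reflection yields
   [b - a] or [a - b]. *)
have [z11|z21] : z1 = 1 \/ z2 = 1 by nia.
  by rewrite -opprB; apply: root_opp; have := root_refl aP bP; rewrite reflE E1 z11 scale1r.
by have := root_refl bP aP; rewrite reflE E2 z21 scale1r.
Qed.

(** * The Weyl group *)

Lemma weyl1 : W 1%:M.
Proof. by exists [::]. Qed.

Lemma weyl_simple w i : W w -> W (w *m s_ (simple D i)).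
Proof. by case=> l ->; exists (i :: l). Qed.

Lemma weyl_ind (P : 'M[R]_n -> Prop) : P 1%:M ->
  (forall w i, W w -> P w -> P (w *m s_ (simple D i))) -> forall w, W w -> P w.
Proof.
move=> P1 Ps w [l ->]; elim: l => //= i l IH; apply: Ps => //; by exists l.
Qed.

Lemma weyl_mul u w : W u -> W w -> W (u *m w).
Proof.
move=> Wu; move: w; apply: weyl_ind; first by rewrite mulmx1.
by move=> w i _ IH; rewrite mulmxA; apply: weyl_simple.
Qed.

Lemma weyl_ip w : W w -> forall u v, ip (u *m w) (v *m w) = ip u v.
Proof.
move: w; apply: weyl_ind => [|w i _ IH] u v; first by rewrite !mulmx1.
by rewrite !mulmxA ip_refl ?IH // (root_neq0 (simple_root i)).
Qed.

Lemma weyl_root w a : W w -> a \in Phi -> a *m w \in Phi.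
Proof.
move=> Ww; move: w Ww a; apply: weyl_ind => [|w i _ IH] a aP; first by rewrite mulmx1.
by rewrite mulmxA root_refl ?simple_root ?IH.
Qed.

Lemma refl_unit a : a != 0 -> s_ a \in unitmx.
Proof. by move=> a0; case: (mulmx1_unit (reflK pB a0)). Qed.

Lemma weyl_unit w : W w -> w \in unitmx.
Proof.
move: w; apply: weyl_ind => [|w i _ IH]; first exact: unitmx1.
by rewrite unitmx_mul IH refl_unit // (root_neq0 (simple_root i)).
Qed.

Lemma weyl_conj w b : W w -> s_ b *m w = w *m s_ (b *m w).
Proof. by move=> Ww; apply: refl_conj => //; apply: weyl_ip. Qed.

Lemma refl_opp a : s_ (- a) = s_ a.
Proof.
apply: mulmx_ext => v; rewrite !reflE ipNl !(ipNr pB) opprK.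
by rewrite scalerN mulrN mulNr scaleNr opprK.
Qed.

Lemma coord_simple i j : coord D (simple D i) 0 j = (i == j)%:R.
Proof.
have -> : simple D i = \sum_l (i == l)%:R *: simple D l; last by rewrite coord_comb.
by rewrite (bigD1 i) //= eqxx scale1r big1 ?addr0 // => l; rewrite eq_sym => /negPf ->;
  rewrite scale0r.
Qed.

(** Induction on the height: a suitable simple reflection [s_b] takes [a] to a lower positive root
    [c], and [s_a] is the conjugate of [s_c] by [s_b]. *)
Lemma weyl_refl_pos a : a \in pos -> W (s_ a).
Proof.
move=> aP; have [m0 Em] := pos_height aP.
have [m lt] : exists m : nat, theta a < m%:R by exists m0.+1; rewrite Em ltr_nat.
elim: m a aP {m0 Em} lt => [|m IH] a aP lt; first by have := theta_pos aP; rewrite ltNge (ltW lt).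
(* Expanding the left argument of [ip a a > 0] over the base leaves some positive term. *)
have [i ai] : exists i, 0 < coord D a 0 i * ip (simple D i) a.
  have : 0 < ip a a by rewrite (ip_gt0 pB) // root_neq0 // pos_root.
  rewrite -{1}(coordK a) mulmx_sum_row.
  have -> : ip (\sum_i coord D a 0 i *: row i D) a = \sum_i coord D a 0 i * ip (simple D i) a.
    elim/big_rec2: _ => [|i x y _ <-]; first exact: ip0l.
    by rewrite ipDl // ipZl.
  move=> S; apply/existsP; apply: contraTT S => /existsPn H; rewrite -leNgt.
  by apply: sumr_le0 => i _; rewrite leNgt H.
set b := simple D i in ai.
have [aPhi Hc] := posP _ aP; have bPhi : b \in Phi by apply: simple_root.
have ipab : 0 < ip b a.
  by rewrite -(pmulr_rgt0 _ (_ : 0 < coord D a 0 i)) // lt_def Hc andbT;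
    apply: contraTneq ai => ->; rewrite mul0r ltxx.
have [<-|ab] := eqVneq b a.
  by have := weyl_simple i weyl1; rewrite mul1mx.
have b1 : theta b = 1.
  rewrite /theta (eq_bigr _ (fun j _ => coord_simple i j)).
  by rewrite (bigD1 i) //= eqxx big1 ?addr0 // => j; rewrite eq_sym => /negPf ->.
pose c := a *m s_ b; have cP : c \in Phi by apply: root_refl.
have [z Ez] := root_int bPhi aPhi.
have z1 : 1 <= z.
  by rewrite -gtz0_ge1 -(ltr0z R) -Ez divr_gt0 ?mulr_gt0 // 1?ipC // (ip_gt0 pB) // root_neq0.
have cE : c = a - z%:~R *: b by rewrite /c reflE Ez.
(* Only the coordinate [i] changes under [s_b]; if [c] were negative, all other coordinates of [a]
   would vanish and [a] would be [b]. *)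
have cpos : c \in pos.
  case: (root_sign cP) => // ncP.
  have [_ Hn] := posP _ ncP; case/negP: ab; apply/eqP.
  have cj j : j != i -> coord D a 0 j = 0.
    move=> ji; apply/eqP; rewrite eq_le Hc andbT; have := Hn j.
    have -> : - c = -1 *: a + z%:~R *: b by rewrite cE opprB scaleN1r addrC.
    rewrite coord_lin -[_ *: b]addr0 coord_lin coord_simple eq_sym (negPf ji) mulr0 add0r.
    by rewrite coord0 [X in _ + X]mxE addr0 mulN1r oppr_ge0.
  have Ea : a = coord D a 0 i *: b.
    rewrite -[LHS]coordK mulmx_sum_row (bigD1 i) //= big1 ?addr0 // => j /cj ->.
    by rewrite scale0r.
  rewrite Ea; have [->|E] : coord D a 0 i = 1 \/ coord D a 0 i = -1 by apply: (root_scale bPhi);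
    rewrite -Ea.
    by rewrite scale1r.
  by have := Hc i; rewrite E oppr_ge0 ler10.
have Wc : W (s_ c).
  apply: IH => //; rewrite cE linearB linearZ /= b1 mulr1 ltrBlDr (lt_le_trans lt) //.
  by rewrite -addn1 natrD lerD2l -[1]/(1%:~R) ler_int.
have Wb : W (s_ b) by have := weyl_simple i weyl1; rewrite mul1mx.
have -> : s_ a = s_ b *m s_ c *m s_ b; last by apply: weyl_mul => //; apply: weyl_mul.
by rewrite -(weyl_conj a Wb) -mulmxA reflK ?mulmx1 // root_neq0.
Qed.

Lemma weyl_refl a : a \in Phi -> W (s_ a).
Proof.
move=> /root_sign[/weyl_refl_pos //|/weyl_refl_pos]; by rewrite refl_opp.
Qed.

Lemma form_unit : B \in unitmx.
Proof.
rewrite -row_free_unit; apply/row_freeP; have [_ H] := pB.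
suff : kermx B == 0 by rewrite -mxrank_eq0 mxrank_ker subn_eq0 => le; apply/row_freeP;
  rewrite /row_free eqn_leq rank_leq_row.
apply/eqP/row_matrixP => i; rewrite row0; apply/eqP; apply: contraTT isT => /H.
by rewrite /Defs.form -row_mul mulmx_ker row0 mul0mx mxE ltxx.
Qed.

(** The vector [c] representing the height is strictly dominant; [theta (c *m w)] will order the
    Weyl group. *)
Lemma theta_dual : exists c : vec, forall v, ip c v = theta v.
Proof.
pose t : 'cV[R]_n := pinvmx D *m const_mx 1.
have tE v : theta v = (v *m t) 0 0.
  by rewrite /t mulmxA mxE; apply: eq_bigr => i _; rewrite [const_mx _ _ _]mxE mulr1.
exists (t^T *m invmx B) => v; rewrite /Defs.form mulmxKV ?form_unit // tE.
by rewrite -trmx_mul mxE.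
Qed.

(** * Flats of rank two *)

Section RankTwo.
Variables (m : nat) (U : 'M[R]_(m, n)).
Hypothesis rU : (\rank U <= 2)%N.

Definition lpos (v : vec) : bool := (v \in pos) && (v <= U)%MS.

(** Simplicity in the subsystem cut out by [U] is indecomposability, as the simple roots of the
    subsystem need not belong to the base [D]. *)
Definition lsimple q := lpos q /\ forall u v, lpos u -> lpos v -> q <> u + v.

Lemma lpos_pos v : lpos v -> v \in pos. Proof. by case/andP. Qed.
Lemma lpos_root v : lpos v -> v \in Phi. Proof. by case/andP => /pos_root. Qed.
Lemma lpos_theta v : lpos v -> 0 < theta v. Proof. by case/andP => /theta_pos. Qed.
Lemma lpos_neq0 v : lpos v -> v != 0. Proof. by move/lpos_root/root_neq0. Qed.

Lemma local_sign (a : vec) : a \in Phi -> (a <= U)%MS -> lpos a \/ lpos (- a).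
Proof.
move=> aP aU; case: (root_sign aP) => h; [left|right]; rewrite /lpos h //.
by rewrite eqmx_opp.
Qed.

Lemma local_refl_sub (q v : vec) : (q <= U)%MS -> (v <= U)%MS -> (v *m s_ q <= U)%MS.
Proof. by move=> qU vU; rewrite reflE addmx_sub // eqmx_opp scalemx_sub. Qed.

Lemma lpos_decomp v : lpos v -> lsimple v \/ exists u w, [/\ lpos u, lpos w & v = u + w].
Proof.
move=> pv; case: (excluded_middle_informative (exists u w, [/\ lpos u, lpos w & v = u + w])) => H.
  by right.
by left; split=> // u w pu pw E; apply: H; exists u, w.
Qed.

Lemma lpos_ind (P : vec -> Prop) : (forall q, lsimple q -> P q) ->
  (forall u w, lpos u -> lpos w -> lpos (u + w) -> P u -> P w -> P (u + w)) ->
  forall v, lpos v -> P v.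
Proof.
move=> Ps Pa v pv; have [d Ed] := pos_height (lpos_pos pv).
have [e] := ubnP d; elim: e d v pv Ed => // e IH d v pv Ed de.
case: (lpos_decomp pv) => [/Ps //|[u [w [pu pw E]]]]; rewrite E; move: (pv); rewrite E => puw.
have [du Eu] := pos_height (lpos_pos pu); have [dw Ew] := pos_height (lpos_pos pw).
have Ed' : d = (du + dw)%N.
  by apply/eqP; rewrite -(eqr_nat R) -Ed E linearD /= Eu Ew natrD.
have := lpos_theta pu; have := lpos_theta pw; rewrite Eu Ew !ltr0n => dw0 du0.
by apply: Pa => //; [apply: (IH du) | apply: (IH dw)] => //; lia.
Qed.

(** Otherwise [p - q] is a root of the subsystem, and its sign gives a decomposition of [p] or of
    [q]. *)
Lemma lsimple_obtuse p q : lsimple p -> lsimple q -> p != q -> ip p q <= 0.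
Proof.
move=> [pp Hp] [pq Hq] npq; rewrite leNgt; apply/negP => pos_pq.
have dP := root_sub (lpos_root pp) (lpos_root pq) pos_pq npq.
have [_ pU] := andP pp; have [_ qU] := andP pq.
have dU : (p - q <= U)%MS by rewrite addmx_sub // eqmx_opp.
case: (local_sign dP dU) => h.
  by apply: (Hp (p - q) q h pq); rewrite subrK.
by apply: (Hq (- (p - q)) p h pp); rewrite opprB subrK.
Qed.

Lemma lpos_indep (p q : vec) : lpos p -> lpos q -> p != q -> ~~ (p <= q)%MS.
Proof.
move=> pp pq; apply: contraNN => /sub_rVP[c E].
have := lpos_theta pp; rewrite E linearZ /= => tp.
have [->|c1] : c = 1 \/ c = -1 by apply: (root_scale (lpos_root pq)); rewrite -E;
  apply: lpos_root.
  by rewrite scale1r.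
by move: tp; rewrite c1 mulN1r oppr_gt0 ltNge ltW // lpos_theta.
Qed.

(** Rank two makes a third simple root a combination of [p] and [q], which obtuse angles and
    positive heights rule out. *)
Lemma lsimple_third p q r : lsimple p -> lsimple q -> lsimple r ->
  p != q -> r = p \/ r = q.
Proof.
move=> lp lq lr pq.
case: (eqVneq r p) => [|rp]; first by left.
case: (eqVneq r q) => [|rq]; first by right.
have [pp _] := lp; have [pq' _] := lq; have [pr _] := lr.
have [s [t E]] : exists s t, r = s *: p + t *: q.
  have sub : (col_mx p q <= U)%MS by rewrite col_mx_sub; case/andP: pp => _ ->; case/andP: pq'.
  have rk : (\rank U <= \rank (col_mx p q))%N.
    apply: leq_trans rU _; rewrite -addsmxE addsmxC.
    have : (q < p + q)%MS.
      by rewrite ltmxE addsmxSr addsmx_sub submx_refl andbT lpos_indep.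
    rewrite addsmxC; move/rank_ltmx; rewrite rank_rV (lpos_neq0 pq') addsmxC.
    by rewrite (addsmxC p q).
  have : (r <= col_mx p q)%MS.
    apply: submx_trans (_ : r <= U)%MS _; first by case/andP: pr.
    by rewrite -(geq_leqif (mxrank_leqif_sup sub)).
  case/submxP => C ->; exists (C 0 (lshift 1 0)), (C 0 (rshift 1 0)).
  rewrite -[C]hsubmxK mul_row_col !row_mxEl !row_mxEr.
  by rewrite {1}[lsubmx C]mx11_scalar {1}[rsubmx C]mx11_scalar !mul_scalar_mx.
have rr := ip_gt0 pB (lpos_neq0 pr); have tr := lpos_theta pr.
have tp := lpos_theta pp; have tq := lpos_theta pq'.
have orp : ip r p <= 0 by apply: lsimple_obtuse.
have orq : ip r q <= 0 by apply: lsimple_obtuse.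
have opq : ip p q <= 0 by apply: lsimple_obtuse.
have app := ip_gt0 pB (lpos_neq0 pp); have aqq := ip_gt0 pB (lpos_neq0 pq').
have Ert : theta r = s * theta p + t * theta q by rewrite E linearD /= !linearZ.
have Err : ip r r = s * ip r p + t * ip r q by rewrite {2}E ipDr // !(ipZr pB).
have Erp : ip r p = s * ip p p + t * ip p q.
  by rewrite E ipDl !ipZl (ipC pB q p).
have Erq : ip r q = s * ip p q + t * ip q q by rewrite E ipDl !ipZl.
(* The four sign patterns of [s] and [t] contradict in turn [theta r > 0], [ip r q <= 0],
   [ip r p <= 0] and [ip r r > 0]. *)
exfalso; clear E; have [s0|s0] := leP s 0; have [t0|t0] := leP t 0.
- have := mulr_le0_ge0 s0 (ltW tp); have := mulr_le0_ge0 t0 (ltW tq); lra.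
- have := mulr_le0 s0 opq; have := mulr_gt0 t0 aqq; lra.
- have := mulr_le0 t0 opq; have := mulr_gt0 s0 app; lra.
- have := mulr_ge0_le0 (ltW s0) orp; have := mulr_ge0_le0 (ltW t0) orq; lra.
Qed.

(** [p] is the other local simple root, or 0 when [q] is the only one, and [a] reads the coefficient
    of [p]; as [a q = 0], it is invariant under [s_q]. *)
Lemma local_coords q : lsimple q -> exists (p : vec) (a : vec -> R),
  [/\ p = 0 \/ lpos p, linear_for *%R a, a q = 0 &
      forall v, lpos v -> exists i j : nat, v = i%:R *: p + j%:R *: q /\ a v = i%:R].
Proof.
move=> lq; have [pq _] := lq; have q0 := lpos_neq0 pq.
have add (p : vec) (a : vec -> R) u w : linear_for *%R a ->
    (exists i j : nat, u = i%:R *: p + j%:R *: q /\ a u = i%:R) ->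
    (exists i j : nat, w = i%:R *: p + j%:R *: q /\ a w = i%:R) ->
    (exists i j : nat, u + w = i%:R *: p + j%:R *: q /\ a (u + w) = i%:R).
  move=> la [i [j [Eu au]]] [i' [j' [Ew aw]]]; exists (i + i')%N, (j + j')%N.
  have := la 1 u w; rewrite scale1r mul1r => ->; rewrite au aw !natrD !scalerDl; split=> //.
  by rewrite {1}Eu {1}Ew addrACA.
case: (excluded_middle_informative (exists2 p, lsimple p & p != q)) => [[p lp pq']|H].
  have [pp _] := lp; have /eqP dpq : p *m proj q != 0.
    by apply: contra (lpos_indep pp pq pq') => /eqP/proj_eq0.
  have [j dj] : exists j, (p *m proj q) 0 j != 0.
    apply/existsP; apply: contra_notT dpq => /existsPn H; apply/rowP => j; rewrite [RHS]mxE.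
    by apply/eqP; rewrite -[_ == _]negbK H.
  pose a (v : vec) : R := (v *m proj q) 0 j / (p *m proj q) 0 j.
  have la : linear_for *%R a.
    by move=> c u v; rewrite /a mulmxDl -scalemxAl mxE [X in X + _]mxE mulrDl mulrA.
  have aq : a q = 0 by rewrite /a mul_proj // mxE mul0r.
  have ap : a p = 1 by rewrite /a divff.
  exists p, a; split=> //; first by right.
  apply: lpos_ind => [r lr|u w _ _ _]; last exact: add.
  case: (lsimple_third lp lq lr pq') => ->.
    by exists 1%N, 0%N; rewrite scale1r scale0r addr0.
  by exists 0%N, 1%N; rewrite scale1r scale0r add0r.
exists 0, (fun=> 0); split=> //; first by left.
  by move=> c u v; rewrite mulr0 addr0.
apply: lpos_ind => [r lr|u w _ _ _]; last by apply: add => c u' v'; rewrite mulr0 addr0.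
have [<-|rq] := eqVneq r q; first by exists 0%N, 1%N; rewrite scale1r scale0r add0r.
by case: H; exists r.
Qed.

Lemma local_refl_fix (a : vec -> R) q v : linear_for *%R a -> a q = 0 -> a (v *m s_ q) = a v.
Proof.
by move=> la aq; rewrite reflE addrC -scaleNr la aq mulr0 add0r.
Qed.

Lemma linear_forN (a : vec -> R) v : linear_for *%R a -> a (- v) = - a v.
Proof.
move=> la; have a0 : a 0 = 0.
  by have := la (-1) 0 0; rewrite scaler0 addr0 mulN1r addNr.
by have := la (-1) v 0; rewrite scaleN1r addr0 a0 addr0 mulN1r.
Qed.

Lemma lpos_scale (q : vec) (c : R) : lpos q -> lpos (c *: q) -> c *: q = q.
Proof.
move=> pq pc; have [->|c1] := root_scale (lpos_root pq) (lpos_root pc); first by rewrite scale1r.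
by have := lpos_theta pc; rewrite c1 scaleN1r linearN /= oppr_gt0 ltNge ltW // lpos_theta.
Qed.

(** The coordinate [a] is nonnegative on local positive roots and fixed by [s_q]; if [s_q] makes [v]
    negative, it is 0 and [v] is a multiple of [q]. *)
Lemma lpos_refl q v : lsimple q -> lpos v -> v != q -> lpos (v *m s_ q).
Proof.
move=> lq pv vq; have [pq _] := lq; have [p [a [_ la aq co]]] := local_coords lq.
have [_ qU] := andP pq; have [_ vU] := andP pv.
have vP : v *m s_ q \in Phi by rewrite root_refl // lpos_root.
case: (local_sign vP (local_refl_sub qU vU)) => // pn.
have [i [j [Ev av]]] := co _ pv; have [i' [j' [En an]]] := co _ pn.
have aN : a (- (v *m s_ q)) = - a v.
  by rewrite linear_forN // local_refl_fix.
have i0 : i = 0%N.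
  by apply/eqP; move: an; rewrite aN av => E; have := ler0n R i; have := ler0n R i';
    rewrite -(eqr_nat R); lra.
move: Ev; rewrite i0 scale0r add0r => Ev; case/negP: vq; apply/eqP.
by rewrite Ev; apply: lpos_scale => //; rewrite -Ev.
Qed.

Lemma lsimple_exists (f : vec -> R) : linear_for *%R f ->
  forall v, lpos v -> 0 < f v -> exists2 q, lsimple q & 0 < f q.
Proof.
move=> lf; apply: lpos_ind => [q lq fq|u w _ _ _ IHu IHw]; first by exists q.
have := lf 1 u w; rewrite scale1r mul1r => ->.
by have [/IHu //|fu] := ltP 0 (f u); have [/IHw //|fw] := ltP 0 (f w); lra.
Qed.

(** * Classes by edge type and the local Bruhat order *)

Local Notation mp := {mpoly R[k]}.

(* In the row-vector convention [b *m w] is the root w(b), and [refl B b *m w] is w s_b,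
   which equals s_{w(b)} w: the edges of type [b] are written by right multiplication. *)
Definition gkm_right (H : pred vec) (P : 'M[R]_n -> mp) :=
  forall w b, W w -> H b -> dvdmp (lin D (b *m w)) (P w - P (s_ b *m w)).

Definition neg_at (H : pred vec) (w : 'M[R]_n) : pred vec :=
  fun b => H b && (theta (b *m w) < 0).

Definition euler_right H w : mp := \prod_(b <- pos | neg_at H w b) lin D (- (b *m w)).

(** Steps use all local positive roots, not only those of [H], so the support condition is
    insensitive to a change of [H]. *)
Definition up_step (y z : 'M[R]_n) :=
  exists b, [/\ lpos b, 0 < theta (b *m y) & z = s_ b *m y].

Definition above := clos_refl_trans _ up_step.

Lemma theta_weyl_sign b w : b \in Phi -> W w -> (theta (b *m w) < 0) = ~~ (0 < theta (b *m w)).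
Proof.
move=> bP Ww; have := theta_neq0 (weyl_root Ww bP).
by rewrite -leNgt [RHS]le_eqVlt => /negPf ->.
Qed.

Lemma above_weyl x y : W x -> above x y -> W y.
Proof.
move=> Wx xy; elim: xy Wx => [u v [b [pb _ ->]] Wu|//|u v w _ IH1 _ IH2 /IH1/IH2 //].
by apply: weyl_mul => //; apply/weyl_refl/lpos_root.
Qed.

Lemma above_ind_right x (Q : 'M[R]_n -> Prop) : Q x ->
  (forall y z, above x y -> up_step y z -> Q y -> Q z) -> forall y, above x y -> Q y.
Proof.
move=> Qx Qs y /clos_rt_rtn1_iff; elim=> // u v uv xu IH; apply: (Qs u) => //.
exact/clos_rt_rtn1_iff.
Qed.

(* The lifting property of the Bruhat order. *)
Lemma above_lift q x : lsimple q -> 0 < theta (q *m x) ->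
  forall y, above (s_ q *m x) y -> above x y /\ above x (s_ q *m y).
Proof.
move=> lq qx; have [pq _] := lq; have q0 := lpos_neq0 pq.
apply: above_ind_right => [|y z _ [b [pb tb ->]] [xy xqy]].
  split; first by apply: rt_step; exists q.
  by rewrite mulmxA reflK // mul1mx; apply: rt_refl.
split; first by apply: rt_trans xy _; apply: rt_step; exists b.
have [->|bq] := eqVneq b q; first by rewrite mulmxA reflK // mul1mx.
apply: rt_trans xqy _; apply: rt_step; exists (b *m s_ q); split.
- exact: lpos_refl.
- by rewrite mulmxA -[b *m _ *m _]mulmxA reflK // mulmx1.
- by rewrite !mulmxA (weyl_conj _ (weyl_refl (lpos_root pq))) -(mulmxA b) reflK // mulmx1.
Qed.

(** A step of type [b] subtracts from [theta (c *m y)] a positive multiple of [theta (b *m y) > 0],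
    because [ip c b = theta b] is positive. *)
Lemma above_theta c x y : (forall v, ip c v = theta v) -> above x y ->
  x = y \/ theta (c *m y) < theta (c *m x).
Proof.
move=> Hc; elim=> [u v [b [pb tb ->]]|u|u v w _ [->|h1] _ [<-|h2]]; try (by left); try (by right).
- right; rewrite mulmxA reflE mulmxBl -scalemxAl linearB linearZ /= Hc.
  rewrite gtrBl mulr_gt0 // divr_gt0 ?mulr_gt0 ?lpos_theta //.
  by rewrite (ip_gt0 pB) // lpos_neq0.
- by right; apply: lt_trans h1.
Qed.

Lemma above_antisym q x : lsimple q -> 0 < theta (q *m x) -> ~ above (s_ q *m x) x.
Proof.
move=> lq qx ab; have [pq _] := lq; have [c Hc] := theta_dual.
have ab' : above x (s_ q *m x) by apply: rt_step; exists q.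
have ne : s_ q *m x <> x.
  move/(congr1 (fun M => theta (q *m M))).
  by rewrite mulmxA refl_self ?(lpos_neq0 pq) // mulNmx linearN /=; lra.
case: (above_theta Hc ab) => [//|h]; case: (above_theta Hc ab') => [/esym //|h'].
by have := lt_trans h h'; rewrite ltxx.
Qed.

Definition lower (H : pred vec) := forall u v (s : seq vec),
  lpos u -> H v -> all lpos s -> v - u = \sum_(g <- s) g -> H u.

(* For b in Phi the function w |-> b *m w is itself a GKM class. *)
Lemma gkm_right_scale (H H' : pred vec) (s : seq vec) P :
  (forall b, H b -> lpos b) -> (forall b, H b -> ~~ H' b -> b \in s) ->
  gkm_right H' P ->
  gkm_right H (fun w => \prod_(b <- s) lin D (- (b *m w)) * P w).
Proof.
move=> Hp Hs gP w b Ww Hb; have [b'|nb'] := boolP (H' b); last first.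
  (* For a type outside [H'], the factor belonging to [b] itself provides the divisibility at both
     ends of the edge. *)
  have bin := Hs b Hb nb'; have b0 := lpos_neq0 (Hp b Hb).
  apply: dvdmpB; rewrite (big_rem _ bin) /= -mulrA; apply: dvdmp_mulr.
    by rewrite linearN; apply/dvdmpN/dvdmp_refl.
  by rewrite mulmxA refl_self // mulNmx opprK; apply: dvdmp_refl.
have -> f g (x y : mp) : f * x - g * y = (f - g) * x + g * (x - y) by ring.
apply: dvdmpD; last exact/dvdmp_mull/gP.
apply: dvdmp_mulr; elim: s {Hs} => [|c s IH]; first by rewrite !big_nil subrr; apply: dvdmp0.
rewrite !big_cons.
have -> (x y f g : mp) : x * f - y * g = (x - y) * f + y * (f - g) by ring.
apply: dvdmpD; last exact: dvdmp_mull.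
apply: dvdmp_mulr; rewrite mulmxA reflE mulmxBl -scalemxAl -linearB /= opprK.
by rewrite addrA addNr add0r -scaleNr linearZ /= -mul_mpolyC; apply/dvdmp_mull/dvdmp_refl.
Qed.

Definition right_class H x P :=
  [/\ gkm_right H P, P x = euler_right H x & forall y, P y != 0 -> above x y].

Lemma linear_for0 (a : vec -> R) : linear_for *%R a -> a 0 = 0.
Proof. by move=> la; have := la (-1) 0 0; rewrite scaler0 addr0 mulN1r addNr. Qed.

(** [s_q] permutes the members of [H] other than [q], matching the remaining inversions of
    [s_q *m x] with those of [x]; the root [q] is the additional inversion. *)
Lemma euler_right_refl (H : pred vec) q x : lsimple q -> 0 < theta (q *m x) ->
  (forall b, H b -> lpos b) -> H q -> (forall b, H b -> b != q -> H (b *m s_ q)) ->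
  euler_right H (s_ q *m x) = lin D (q *m x) * euler_right H x.
Proof.
move=> lq qx Hp Hq Hs; have [pq _] := lq; have q0 := lpos_neq0 pq.
have qin : q \in [seq b <- pos | neg_at H (s_ q *m x) b].
  by rewrite mem_filter lpos_pos // /neg_at Hq mulmxA refl_self // mulNmx linearN /= oppr_lt0 qx.
rewrite /euler_right -big_filter (bigD1_seq q qin (filter_uniq _ pos_uniq)) /=.
rewrite mulmxA refl_self // mulNmx opprK; congr (_ * _).
rewrite -[LHS]big_filter -filter_predI -[RHS]big_filter; set r1 := filter _ _;
  set r2 := filter _ _.
have Er : perm_eq r2 [seq b *m s_ q | b <- r1].
  apply: uniq_perm; first exact/filter_uniq/pos_uniq.
    rewrite map_inj_uniq; first exact/filter_uniq/pos_uniq.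
    by move=> u v /(can_inj (mulmxK (refl_unit q0))).
  have inv (b : vec) : b *m s_ q *m s_ q = b by rewrite -mulmxA reflK // mulmx1.
  have nq (b : vec) : b *m s_ q = q -> b = - q by move=> E; rewrite -(inv b) E refl_self.
  move=> b; rewrite mem_filter; apply/andP/mapP => [[/andP[Hb tb] bp]|[c]].
    have bq : b != q by apply: contraTneq tb => ->; rewrite -leNgt ltW.
    exists (b *m s_ q); last by rewrite inv.
    rewrite mem_filter /= /neg_at Hs // mulmxA inv tb lpos_pos ?Hp ?Hs // !andbT.
    apply/eqP => /nq Eb; have := lpos_theta (Hp _ Hb); rewrite Eb linearN /= oppr_gt0.
    by rewrite ltNge ltW // lpos_theta.
  rewrite mem_filter => /andP[/andP[/= cq /andP[Hc tc]] cp] ->.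
  by rewrite /neg_at Hs // -mulmxA tc lpos_pos // Hp // Hs.
rewrite (perm_big _ Er) big_map; apply: eq_bigr => b _.
by rewrite mulmxA.
Qed.

(* Divided difference with respect to the local simple root q. *)
Lemma right_class_down (H : pred vec) q x P : W x -> lsimple q -> 0 < theta (q *m x) ->
  (forall b, H b -> lpos b) -> H q -> (forall b, H b -> b != q -> H (b *m s_ q)) ->
  right_class H (s_ q *m x) P -> exists Q, right_class H x Q.
Proof.
move=> Wx lq qx Hp Hq Hs [gP Px Py]; have [pq _] := lq; have q0 := lpos_neq0 pq.
have Wq := weyl_refl (lpos_root pq).
(* The quotient is set to 0 outside the Weyl group, because the support condition ranges over all
   matrices. *)
have quot w : exists f, (W w -> P (s_ q *m w) - P w = f * lin D (q *m w)) /\ (~ W w -> f = 0).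
  case: (excluded_middle_informative (W w)) => Ww; last by exists 0.
  have [f Ef] := gP w q Ww Hq; exists (- f); split=> // _.
  by rewrite mulNr -Ef opprB.
pose Q w := proj1_sig (constructive_indefinite_description _ (quot w)).
have QE w : W w -> P (s_ q *m w) - P w = Q w * lin D (q *m w).
  by rewrite /Q; case: constructive_indefinite_description => f [].
have Q0 w : ~ W w -> Q w = 0.
  by rewrite /Q; case: constructive_indefinite_description => f [].
have lin0 w b : W w -> lpos b -> lin D (b *m w) != 0.
  move=> Ww pb; rewrite lin_eq0; apply: root_neq0; apply: weyl_root => //; exact: lpos_root.
exists Q; split.
- move=> w b Ww Hb; have pb := Hp b Hb; have Wb := weyl_refl (lpos_root pb).
  have [->|bq] := eqVneq b q.
    suff -> : Q (s_ q *m w) = Q w by rewrite subrr; apply: dvdmp0.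
    have := QE _ (weyl_mul Wq Ww); rewrite !mulmxA reflK // mul1mx refl_self // mulNmx linearN /=.
    by rewrite mulrN -opprB => /oppr_inj; rewrite (QE w Ww) => /(mulIf (lin0 _ _ Ww pq)) ->.
  have bw0 : b *m w != 0 by rewrite -lin_eq0 lin0.
  (* The form [lin D (q *m w)] is not proportional to [lin D (b *m w)], so multiplying by it clears
     the denominators harmlessly. *)
  suff : dvdmp (lin D (b *m w)) (lin D (q *m w) * (Q w - Q (s_ b *m w))).
    case/(lin_prime bw0) => // /(dvd_lin_lin bw0) le.
    have nqb : ~~ (q <= b)%MS by apply: lpos_indep => //; rewrite eq_sym.
    by case/negP: nqb; have := submxMr (invmx w) le; rewrite !mulmxK ?weyl_unit.
  pose b' := b *m s_ q; have Hb' : H b' by apply: Hs.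
  have E1 : P (s_ q *m (s_ b *m w)) = P (s_ b' *m (s_ q *m w)).
    by rewrite !mulmxA (weyl_conj b' Wq) /b' -(mulmxA b) reflK // mulmx1.
  have E2 : q *m (s_ b *m w) = q *m w - (2 * ip q b / ip b b) *: (b *m w).
    by rewrite mulmxA reflE mulmxBl -scalemxAl.
  have D1 := QE _ Ww; have D2 := QE _ (weyl_mul Wb Ww).
  rewrite E1 E2 linearB linearZ /= in D2.
  have -> : lin D (q *m w) * (Q w - Q (s_ b *m w)) =
      (P (s_ q *m w) - P (s_ b' *m (s_ q *m w))) - (P w - P (s_ b *m w))
      - Q (s_ b *m w) * ((2 * ip q b / ip b b) *: lin D (b *m w)).
    have -> (A A' P0 P1 : mp) : (A - A') - (P0 - P1) = (A - P0) - (A' - P1) by ring.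
    by rewrite D1 D2; ring.
  apply: dvdmpB; first apply: dvdmpB.
  + have := gP _ _ (weyl_mul Wq Ww) Hb'.
    by rewrite [b' *m _]mulmxA /b' -(mulmxA b) reflK // mulmx1.
  + exact: gP.
  + by apply: dvdmp_mull; rewrite -mul_mpolyC; apply/dvdmp_mull/dvdmp_refl.
- apply: (mulIf (lin0 x q Wx pq)); rewrite -(QE x Wx) Px euler_right_refl //.
  have -> : P x = 0 by apply/eqP; apply: contra_notT (above_antisym lq qx) => /Py.
  by rewrite subr0 mulrC.
- move=> y Qy; have Wy : W y by case: (excluded_middle_informative (W y)) => // /Q0 E;
  rewrite E eqxx in Qy.
  have [yz|] := eqVneq (P y) 0; last by move/Py/(above_lift lq qx) => [].
  have : P (s_ q *m y) != 0.
    apply: contraNneq Qy => yz'; have := QE y Wy; rewrite yz yz' subrr => /esym/eqP.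
    by rewrite mulf_eq0 (negPf (lin0 _ _ Wy pq)) orbF.
  move/Py/(above_lift lq qx) => [_]; by rewrite mulmxA reflK // mul1mx.
Qed.

(** All labels at [x] of types in [H] divide the Euler product, so the function supported at [x]
    alone is a class. *)
Lemma right_class_top (H : pred vec) x : W x -> (forall b, H b -> lpos b) ->
  (forall b, lpos b -> theta (b *m x) < 0) -> exists P, right_class H x P.
Proof.
move=> Wx Hp neg; exists (fun y => if y == x then euler_right H x else 0); split.
- have ex b : H b -> dvdmp (lin D (b *m x)) (euler_right H x).
    move=> Hb; have pb := Hp b Hb; have bin : b \in [seq c <- pos | neg_at H x c] by rewrite
      mem_filter /neg_at Hb neg // lpos_pos.
    rewrite /euler_right -big_filter (big_rem _ bin) /=.
    by apply: dvdmp_mulr; rewrite linearN; apply/dvdmpN/dvdmp_refl.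
  move=> w b Ww Hb; have b0 := lpos_neq0 (Hp b Hb).
  apply: dvdmpB; case: eqP => E; rewrite ?E; try exact: dvdmp0; first exact: ex.
  have Ew : w = s_ b *m x by rewrite -E mulmxA reflK // mul1mx.
  rewrite Ew mulmxA refl_self // mulNmx linearN.
  by have [q ->] := ex b Hb; exists (- q); rewrite mulrNN.
- by rewrite eqxx.
- by move=> y; have [->|_] := eqVneq y x; [move=> _; apply: rt_refl | rewrite eqxx].
Qed.

(** The roots of [H] missing from [H'] supply, as factors, the missing edge conditions and the
    missing Euler factors; those of [H'] outside [H] are positive at [x] and contribute no Euler
    factor. *)
Lemma right_class_change (H H' : pred vec) x P : W x ->
  (forall b, H b -> lpos b) -> (forall b, H' b -> lpos b) ->
  (forall b, H b -> ~~ H' b -> theta (b *m x) < 0) ->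
  (forall b, H' b -> ~~ H b -> 0 < theta (b *m x)) ->
  right_class H' x P -> exists Q, right_class H x Q.
Proof.
move=> Wx Hp Hp' Hneg Hpos [gP Px Py].
pose s := [seq b <- pos | H b && ~~ H' b].
exists (fun w => \prod_(b <- s) lin D (- (b *m w)) * P w); split.
- apply: gkm_right_scale gP => // b Hb nb; by rewrite mem_filter Hb nb lpos_pos ?Hp.
- rewrite Px /euler_right /s big_filter [RHS](bigID H') /= mulrC; congr (_ * _).
    apply: eq_bigl => b; rewrite /neg_at; case: (boolP (H b)) => Hb;
      case: (boolP (H' b)) => H'b //=;
      rewrite ?andbT ?andbF //.
    by rewrite ltNge ltW // Hpos.
  apply: eq_bigl => b; rewrite /neg_at; case: (boolP (H b)) => Hb;
    case: (boolP (H' b)) => H'b //=.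
    by rewrite ?andbF.
  by rewrite Hneg.
- by move=> y yz; apply: Py; apply: contraNneq yz => ->; rewrite mulr0.
Qed.

(* Sets that are lower and stable under s_q are the sublevel sets of the coordinate a
   along the other local simple root p. *)
Lemma rank2_class (H : pred vec) x : W x -> (forall b, H b -> lpos b) -> lower H ->
  exists P, right_class H x P.
Proof.
pose posx x := [seq b <- pos | lpos b && (0 < theta (b *m x))].
have [N] := ubnP (size (posx x)); elim: N H x => // N IH H x le Wx Hp Hl.
case: (excluded_middle_informative (exists2 v, lpos v & 0 < theta (v *m x))) => [[v pv vx]|top];
  last first.
  apply: right_class_top => // b pb; rewrite theta_weyl_sign ?lpos_root //; apply/negP => bx.
  by apply: top; exists b.
pose f v := theta (v *m x).
have lf : linear_for *%R f by move=> c u w; rewrite /f mulmxDl -scalemxAl linearP.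
have [q lq fq] := lsimple_exists lf pv vx; have [pq _] := lq.
have [p [a [pp la aq co]]] := local_coords lq.
(* The smallest sublevel set of [a] containing [q] and all roots of [H] that [x] keeps positive. *)
pose H' : pred vec := fun b => lpos b &&
  ((a b == 0) || has (fun c => [&& H c, 0 < f c & a b <= a c]) pos).
have Hp' b : H' b -> lpos b by case/andP.
have a_ge0 b : lpos b -> 0 <= a b by move=> /co[i [j [_ ->]]].
have Hs' b : H' b -> b != q -> H' (b *m s_ q).
  move=> /andP[pb Hb] bq; rewrite /H' lpos_refl //= local_refl_fix //.
have Hq' : H' q by rewrite /H' pq aq eqxx.
have Wq := weyl_refl (lpos_root pq); have q0 := lpos_neq0 pq.
have Hl' : lower H'.
  move=> u w s pu /andP[pw Hw] ps E; rewrite /H' pu /=.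
  have auw : a u <= a w.
    have -> : w = 1 *: u + \sum_(g <- s) g by rewrite -E scale1r addrC subrK.
    rewrite la mul1r lerDl; elim: s ps {E} => [|g s IHs] /=; first by rewrite big_nil linear_for0.
    case/andP=> pg ps; rewrite big_cons; have := la 1 g (\sum_(j <- s) j);
      rewrite scale1r mul1r => ->.
    apply: addr_ge0; [exact: a_ge0|exact: IHs].
  case/orP: Hw => [/eqP aw|/hasP[c cp /and3P[Hc fc awc]]].
    by rewrite eq_le a_ge0 // andbT -aw auw.
  by apply/orP; right; apply/hasP; exists c => //; rewrite Hc fc (le_trans auw).
have [|P cP] := IH H' (s_ q *m x) _ (weyl_mul Wq Wx) Hp' Hl'.
  (* The measure drops: [s_q] injects the roots positive at [s_q *m x] into those positive at [x],
     missing [q]. *)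
  rewrite -ltnS (leq_trans _ le) // ltnS.
  have -> : size (posx (s_ q *m x)) = size [seq b *m s_ q | b <- posx (s_ q *m x)] by rewrite
    size_map.
  have qin : q \in posx x by rewrite mem_filter pq fq lpos_pos.
  rewrite (perm_size (perm_to_rem qin)) /= ltnS; apply: uniq_leq_size.
    rewrite map_inj_uniq; first exact/filter_uniq/pos_uniq.
    by move=> u w /(can_inj (mulmxK (refl_unit q0))).
  move=> z /mapP[b]; rewrite mem_filter => /andP[/andP[pb tb] _] ->.
  have bq : b != q.
    apply: contraTneq tb => ->; rewrite mulmxA refl_self // mulNmx linearN /= oppr_gt0.
    by rewrite -leNgt ltW.
  have pbq : lpos (b *m s_ q) by apply: lpos_refl.
  rewrite (mem_rem_uniq _ (filter_uniq _ pos_uniq)) inE /= mem_filter pbq lpos_pos // -mulmxA tb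
    !andbT.
  apply/eqP => E; have := lpos_theta pb.
  have -> : b = - q by rewrite -(refl_self pB q0) -[LHS]mulmx1 -(reflK pB q0) mulmxA E.
  by rewrite linearN /= oppr_gt0 ltNge ltW // lpos_theta.
  
have [Q cQ] := right_class_down Wx lq fq Hp' Hq' Hs' cP.
apply: (right_class_change Wx Hp Hp' _ _ cQ) => b Hb nb.
  rewrite theta_weyl_sign ?lpos_root ?Hp //; apply: contra nb => fb.
  rewrite /H' Hp //=; apply/orP; right; apply/hasP; exists b; first by rewrite lpos_pos ?Hp.
  by rewrite Hb fb lexx.
(* A root [b] of [H'] that [x] makes negative must lie in [H]: it is compared with a root [c] of
   [H], positive at [x], with [a b <= a c]. *)
have pb := Hp' _ Hb; rewrite -[_ < _]negbK -theta_weyl_sign ?lpos_root //; apply/negP => fb.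
have [i [j [Eb ab]]] := co _ pb.
have fE (i' j' : nat) : f (i'%:R *: p + j'%:R *: q) = i'%:R * f p + j'%:R * f q.
  by rewrite lf -[j'%:R *: q]addr0 lf linear_for0 // addr0.
have fb' : i%:R * f p + j%:R * f q < 0 by rewrite -fE -Eb.
have i0 : (0 < i)%N.
  rewrite lt0n; apply: contraTneq fb' => ->; rewrite mul0r add0r -leNgt.
  by rewrite mulr_ge0 ?ler0n // ltW.
case/andP: Hb => _ /orP[/eqP|/hasP[c _ /and3P[Hc fc abc]]].
  by rewrite ab => /eqP; rewrite pnatr_eq0 => /eqP i00; rewrite i00 in i0.
have pc := Hp _ Hc; have [i' [j' [Ec ac]]] := co _ pc.
have ii' : (i <= i')%N by move: abc; rewrite ab ac ler_nat.
have fc' : 0 < i'%:R * f p + j'%:R * f q by rewrite -fE -Ec.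
case/negP: nb; have [jj'|jj'] := leqP j j'.
  (* When [p] is 0 it is not a root, so its copies are left out of the list. *)
  apply: (Hl b c (nseq (j' - j) q ++ (if p == 0 then [::] else nseq (i' - i) p))) => //.
    rewrite all_cat all_nseq pq orbT /=; case: eqP pp => // p0 [//|pp].
    by rewrite all_nseq pp orbT.
  rewrite big_cat /= big_nseq iter_addr_0.
  have -> : \sum_(g <- (if p == 0 then [::] else nseq (i' - i) p)) g = (i' - i)%:R *: p.
    by case: eqP => [->|_]; rewrite ?big_nil ?scaler0 // big_nseq iter_addr_0 scaler_nat.
  rewrite Eb Ec -scaler_nat !natrB // !scalerBl opprD addrACA addrC.
  by [].
(* If [j' < j], cross-multiplying the signs of [f b] and [f c] by [i'] and [i] eliminates [f p] and
   leaves a multiple of [f q > 0] of the wrong sign. *)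
have h1 : (i%:R : R) <= i'%:R by rewrite ler_nat.
have h2 : (j'%:R : R) < j%:R by rewrite ltr_nat.
have h3 : (0 : R) < i%:R by rewrite ltr0n.
have h4 : (0 : R) <= j'%:R by rewrite ler0n.
exfalso; move: (i%:R : R) (i'%:R : R) (j%:R : R) (j'%:R : R) (f p) (f q) fq fb' fc' h1 h2 h3 h4.
move=> x1 x2 y1 y2 P1 Q1 hq hb hc h1 h2 h3 h4.
have x2p : 0 < x2 by apply: lt_le_trans h1.
have k1 : x2 * (x1 * P1 + y1 * Q1) < 0 by rewrite pmulr_rlt0.
have k2 : 0 < x1 * (x2 * P1 + y2 * Q1) by rewrite mulr_gt0.
have k3 : x1 * y2 <= x2 * y2 by apply: ler_wpM2r.
have k4 : x2 * y2 < x2 * y1 by rewrite ltr_pM2l.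
have k5 : 0 < (x2 * y1 - x1 * y2) * Q1 by apply: mulr_gt0 => //;
  rewrite subr_gt0 (le_lt_trans k3).
lra.
Qed.

End RankTwo.

(** * Hessenberg graphs *)

Section Hess.
Variable h : pred 'rV[R]_n.
Hypothesis hs : hessenberg Phi D h.
Local Notation mp := {mpoly R[k]}.

Lemma hess_pos b : h b -> b \in pos.
Proof. by case: hs => H _; apply: H. Qed.

(** The type [b] of an edge is common to both ends, and the Hessenberg condition becomes membership
    of [b] in [h], independent of the vertex. *)
Lemma hedge_right u a w : hedge B Phi D h u a w ->
  exists b, [/\ h b, a = - (b *m w), a = b *m u, u = s_ b *m w & w = s_ b *m u].
Proof.
case=> Wu Ww ap Ew hb; exists (- (a *m invmx w)).
have a0 := root_neq0 (pos_root ap); have uw := weyl_unit Ww.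
have aw : - (a *m invmx w) *m w = - a by rewrite mulNmx mulmxKV.
have Eu : u = s_ (- (a *m invmx w)) *m w.
  by rewrite (weyl_conj _ Ww) aw refl_opp Ew -mulmxA reflK // mulmx1.
have b0 := root_neq0 (pos_root (hess_pos hb)).
split=> //; first by rewrite aw opprK.
  by rewrite Eu mulmxA refl_self // mulNmx aw opprK.
by rewrite [in RHS]Eu mulmxA reflK // mul1mx.
Qed.

Lemma hedge_of_right b w : W w -> h b -> theta (b *m w) < 0 ->
  hedge B Phi D h (s_ b *m w) (- (b *m w)) w.
Proof.
move=> Ww hb tb; have bP := pos_root (hess_pos hb).
have b0 := root_neq0 bP; have bwP := weyl_root Ww bP.
split=> //.
- by apply: weyl_mul => //; apply: weyl_refl.
- by rewrite posE root_opp // linearN oppr_gt0.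
- by rewrite refl_opp (weyl_conj b Ww) -mulmxA reflK ?mulmx1 ?root_neq0.
- by rewrite mulNmx mulmxK ?weyl_unit // opprK.
Qed.

Lemma lpos_full a : a \in pos -> lpos (1%:M : 'M[R]_n) a.
Proof. by rewrite /lpos => ->; apply: submx1. Qed.

Lemma hedge_up u a w : hedge B Phi D h u a w -> up_step (1%:M : 'M[R]_n) u w.
Proof.
move=> e; have [b [hb _ Ea _ Ew]] := hedge_right e; have [_ _ ap _ _] := e.
by exists b; split; [apply/lpos_full/hess_pos | rewrite -Ea theta_pos | ].
Qed.

Lemma pbP P : reflect P (pb P).
Proof. by rewrite /pb; case: excluded_middle_informative => H; constructor. Qed.

(** The roots span, so an element is determined by the self-map it induces on the finite list
    [Phi]. *)
Lemma weyl_finite : exists s : seq 'M[R]_n, uniq s /\ forall w, w \in s <-> W w.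
Proof.
pose N := size Phi.
pose ok (f : {ffun 'I_N -> 'I_N}) w := W w /\ forall i : 'I_N, nth 0 Phi i *m w = nth 0 Phi (f i).
have ex f : exists o : option 'M[R]_n,
    (forall w, o = Some w -> ok f w) /\ (forall w, ok f w -> exists w', o = Some w').
  case: (excluded_middle_informative (exists w, ok f w)) => [[w Hw]|H].
    by exists (Some w); split=> [_ [<-] //|]; exists w.
  by exists None; split=> // w Hw; case: H; exists w.
pose g f := proj1_sig (constructive_indefinite_description _ (ex f)).
have gP f : (forall w, g f = Some w -> ok f w) /\ (forall w, ok f w -> exists w', g f = Some w').
  exact: proj2_sig (constructive_indefinite_description _ (ex f)).
exists (undup (pmap g (enum {ffun 'I_N -> 'I_N}))); split=> [|w]; first exact: undup_uniq.
rewrite mem_undup mem_pmap; split=> [/mapP[f _ /esym Ef]|Ww]; first by have [/(_ _ Ef)[]] := gP f.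
have ltf (i : 'I_N) : (index (nth 0%R Phi i *m w) Phi < N)%N.
  by rewrite index_mem weyl_root // mem_nth.
have okf : ok [ffun i => Ordinal (ltf i)] w.
  by split=> // i; rewrite ffunE nth_index // weyl_root // mem_nth.
set f := finfun _ in okf; have [g1 g2] := gP f; have [w' Ew'] := g2 _ okf.
suff <- : w' = w by apply/mapP; exists f; rewrite ?mem_enum.
have [_ ok'] := g1 _ Ew'; have [_ okw] := okf.
apply: mulmx_ext => v; have [[_ _ sp] _] := rs; have [c ->] := sp v.
rewrite !mulmx_suml; rewrite !big_seq; apply: eq_bigr => a aP; rewrite -!scalemxAl;
  congr (_ *: _).
have lt : (index a Phi < N)%N by rewrite index_mem.
by have := ok' (Ordinal lt); rewrite -(okw (Ordinal lt)) /= nth_index.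
Qed.

(** Sorting by decreasing [theta (c *m w)] gives one numbering compatible with the local Bruhat
    orders of all flats at once. *)
Lemma weyl_enum : exists s : seq 'M[R]_n, [/\ uniq s, forall w, w \in s <-> W w &
  forall m (U : 'M[R]_(m, n)) u w, W u -> above U u w -> u = w \/ (index u s < index w s)%N].
Proof.
have [c Hc] := theta_dual; have [s0 [us0 Hs0]] := weyl_finite.
pose r (u w : 'M[R]_n) := theta (c *m w) <= theta (c *m u).
have rtr : transitive r by move=> v u w; rewrite /r => h1 h2; apply: le_trans h1.
have rtot : total r by move=> u w; apply: le_total.
exists (sort r s0); split; first by rewrite sort_uniq.
  by move=> w; rewrite mem_sort.
move=> m U u w Wu uw; have Ww := above_weyl Wu uw.
case: (above_theta Hc uw) => [|lt]; [by left | right].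
have us : u \in sort r s0 by rewrite mem_sort; apply/Hs0.
have ws : w \in sort r s0 by rewrite mem_sort; apply/Hs0.
rewrite ltnNge; apply: contraTN lt; rewrite -leNgt.
exact: (sorted_leq_index rtr (fun u => lexx _) (sort_sorted rtot s0)).
Qed.

(** * The Hessenberg graph as a numbered graph *)

Section Enumerated.
Variable s : seq 'M[R]_n.
Hypotheses (us : uniq s) (sW : forall w, w \in s <-> W w).
Hypothesis s_above : forall m (U : 'M[R]_(m, n)) u w,
  W u -> above U u w -> u = w \/ (index u s < index w s)%N.
Local Notation N := (size s).

Lemma mx_weyl (i : 'I_N) : W (nth 0 s i).
Proof. by apply/sW; apply: mem_nth. Qed.

Lemma hedge_index u a w : hedge B Phi D h u a w -> (index u s < index w s)%N.
Proof.
move=> e; have up := hedge_up e; have [Wu _ ap Ew _] := e.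
case: (s_above Wu (rt_step _ _ _ _ up)) => // E.
have [b [hb Ea _ Eu _]] := hedge_right e; have b0 := root_neq0 (pos_root (hess_pos hb)).
have := theta_pos ap; rewrite Ea -[in theta _]E Eu mulmxA refl_self // mulNmx opprK.
have := theta_pos ap; rewrite Ea linearN /=; lra.
Qed.

Definition incoming (w : 'M[R]_n) := [seq a <- pos | pb (exists u, hedge B Phi D h u a w)].

(* The default value of [insubd] is never met: W is closed under reflections. *)
Definition hess_edges : edges R N k := fun x =>
  [seq (insubd x (index (nth 0 s x *m s_ a) s), coord D a) | a <- incoming (nth 0 s x)].

Lemma incomingP w a : reflect (exists u, hedge B Phi D h u a w) (a \in incoming w).
Proof.
rewrite mem_filter; apply: (iffP andP) => [[/pbP //]|[u e]].
by split; [apply/pbP; exists u | have [] := e].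
Qed.

Lemma insub_index (x : 'I_N) (w : 'M[R]_n) : W w -> nth 0 s (insubd x (index w s)) = w.
Proof.
by move/sW => ws; rewrite val_insubd index_mem ws nth_index.
Qed.

Lemma hess_edgesP (w : 'I_N) e : e \in hess_edges w -> exists u a,
  [/\ hedge B Phi D h u a (nth 0 s w), nth 0 s e.1 = u, e.2 = coord D a & (e.1 < w)%N].
Proof.
case/mapP => a /incomingP[u e'] -> /=; have [Wu Ww ap Ew _] := e'; exists u, a.
have Eu : nth 0 s w *m s_ a = u.
  by rewrite Ew -mulmxA reflK ?mulmx1 ?root_neq0 ?pos_root.
rewrite Eu insub_index //; split=> //.
have := hedge_index e'; rewrite index_uniq // => lt.
by rewrite val_insubd index_mem (proj2 (sW u) Wu).
Qed.

Lemma hess_edges_wf : wf_edges hess_edges.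
Proof.
move=> w; split=> [e /hess_edgesP[u [a [e' _ -> lt]]]|].
  by rewrite coord_eq0 root_neq0 // pos_root //; have [] := e'.
have up : pairwise [rel a b | a != b] (incoming (nth 0 s w)).
  by rewrite -uniq_pairwise; apply/filter_uniq/pos_uniq.
rewrite pairwise_map; apply: sub_in_pairwise (allss _) up => a b.
move=> /incomingP[u [_ _ ap _ _]] /incomingP[v [_ _ bp _ _]] /= ab; apply/negP => /sub_coord.
by apply/negP; apply: (lpos_indep (lpos_full bp) (lpos_full ap)); rewrite eq_sym.
Qed.

(** Steps use reflections in roots of the pulled-back flat, which preserve it; hence labels in [V]
    have types in this same flat at every vertex above [X]. *)
Lemma above_invmx m (V : 'M[R]_(m, n)) X y (v : vec) : W X -> above (V *m invmx X) X y ->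
  (v <= V)%MS -> (v *m invmx y <= V *m invmx X)%MS.
Proof.
move=> WX ab; move: y ab v; apply: above_ind_right => [v vV|y z xy [b [pb _ ->]] IH v vV].
  exact: submxMr.
have Wy := above_weyl WX xy; have b0 := lpos_neq0 pb; have [_ bU] := andP pb.
have -> : v *m invmx (s_ b *m y) = v *m invmx y *m s_ b; last by apply: local_refl_sub => //;
  apply: IH.
apply: (can_inj (mulmxK (_ : s_ b *m y \in unitmx))).
  by rewrite unitmx_mul refl_unit // weyl_unit.
rewrite mulmxKV ?unitmx_mul ?refl_unit ?weyl_unit //.
by rewrite mulmxA -[_ *m s_ b *m s_ b]mulmxA reflK // mulmx1 mulmxKV ?weyl_unit.
Qed.

(** Pulled back by [X], labels in the flat become types in [U'], where the members of [h] form a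
    lower set and [rank2_class] applies. *)
Lemma good_hess_rank2 m (U : 'M[R]_(m, k)) : (\rank U <= 2)%N -> good (restr hess_edges U).
Proof.
move=> rU x; set X := nth 0 s x; have WX : W X by apply: mx_weyl.
pose V := U *m D; pose U' := V *m invmx X.
have rU' : (\rank U' <= 2)%N.
  by apply: leq_trans (mxrankM_maxl _ _) _; apply: leq_trans (mxrankM_maxl _ _) rU.
have VU a : (coord D a <= U)%MS = (a <= V)%MS.
  have [_ fD _] := bs.
  apply/idP/idP => [aU|/(submxMr (pinvmx D))]; last by rewrite /V mulmxKp.
  by rewrite -(coordK a); apply: submxMr.
pose H : pred vec := fun b => h b && (b <= U')%MS.
have Hp b : H b -> lpos U' b by case/andP => hb bU; rewrite /lpos hess_pos.
have Hl : lower U' H.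
  move=> u v l pu /andP[hv _] pl E; rewrite /H; have [up ->] := andP pu; rewrite andbT.
  apply/negPn/negP => nh; case: hs => _ hs2.
  suff : ~~ h v by rewrite hv.
  apply: (hs2 u v) => //; first exact: hess_pos.
  by exists l; split=> //; apply: sub_all pl => g /lpos_pos.
have [Q [gQ Qx Qy]] := rank2_class rU' WX Hp Hl.
exists (fun y : 'I_N => Q (nth 0 s y)); split.
- move=> w e; rewrite mem_filter => /andP[eU /hess_edgesP[u [a [e' -> Ea _]]]].
  rewrite Ea VU in eU; rewrite Ea -linE; set y := nth 0 s w in e' *.
  have [b [hb Eaw Eau Euw _]] := hedge_right e'; have [Wu Wy _ _ _] := e'.
  (* Unless both values vanish, one end of the edge is above [X], which places its type in [U']. *)
  have [Qu|/Qy au] := eqVneq (Q u) 0; last first.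
    have Hb : H b.
      rewrite /H hb -(mulmxK (weyl_unit Wu) b) -Eau; exact: above_invmx.
    by rewrite -opprB Eaw linearN; have [q Eq] := gQ _ _ Wy Hb; exists q; rewrite Euw Eq mulrN.
  have [Qy0|/Qy ay] := eqVneq (Q y) 0; first by rewrite Qu Qy0 subrr; apply: dvdmp0.
  have Hb : H b.
    rewrite /H hb -[b]opprK eqmx_opp -(mulmxK (weyl_unit Wy) (- b)) mulNmx -Eaw.
    exact: above_invmx.
  by rewrite -opprB Eaw linearN; have [q Eq] := gQ _ _ Wy Hb; exists q; rewrite Euw Eq mulrN.
- rewrite Qx /euler_right /euler /restr big_filter /hess_edges big_map /= -/X.
  rewrite [RHS](eq_bigl (fun a => (a <= V)%MS)); last by move=> a; apply: VU.
  rewrite -[RHS]big_filter -filter_predI -[LHS]big_filter.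
  set r1 := filter _ _; set r2 := filter _ _.
  have Er : perm_eq r2 [seq - (b *m X) | b <- r1].
    apply: uniq_perm; first exact/filter_uniq/pos_uniq.
      rewrite map_inj_uniq; first exact/filter_uniq/pos_uniq.
      by move=> u v /oppr_inj/(can_inj (mulmxK (weyl_unit WX))).
    move=> a; rewrite mem_filter; apply/andP/mapP => [[/andP[aV /pbP[u e]] ap]|[b]].
      have [b [hb Ea _ _ _]] := hedge_right e; exists b => //.
      rewrite mem_filter hess_pos // /neg_at /H hb andbT /=; apply/andP; split.
        rewrite -(mulmxK (weyl_unit WX) b) /U'; apply: submxMr.
        by rewrite -[b *m X]opprK -Ea eqmx_opp.
      by rewrite -[b *m X]opprK -Ea linearN /= oppr_lt0 theta_pos.
    rewrite mem_filter => /andP[/andP[/andP[hb bU] tb] bp] ->; have e := hedge_of_right WX hb tb.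
    have [_ _ ap _ _] := e; split=> //; apply/andP; split; last by apply/pbP; eexists; apply: e.
    rewrite eqmx_opp /=; have := submxMr X bU; by rewrite /U' mulmxKV ?weyl_unit.
  by rewrite (perm_big _ Er) big_map; apply: eq_bigr => b _; rewrite linE.
- move=> y yx; apply/eqP; apply: contraTT yx => /Qy ab; rewrite -leqNgt.
  by case: (s_above WX ab) => [E|]; [move/eqP: E; rewrite nth_uniq // => /eqP -> |
    rewrite /X !index_uniq // => /ltnW].
Qed.

Lemma good_hess : good hess_edges.
Proof. exact: good_of_rank2_flats hess_edges_wf good_hess_rank2. Qed.

(** * Triangular elimination and flow-up classes *)

Local Notation GKM := (gkm B Phi D h).
Local Notation FU := (flowup B Phi D h).
Local Notation ix w := (index w s).
Local Notation inc w := (\prod_(a <- posroots Phi D | pb (exists u, hedge B Phi D h u a w)) lin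
  D a).

Lemma ix_lt w : W w -> (ix w < N)%N.
Proof. by move/sW; rewrite index_mem. Qed.

Lemma ix_inj u w : W u -> W w -> ix u = ix w -> u = w.
Proof. by move=> /sW us' /sW ws E; rewrite -(nth_index 0 us') E nth_index. Qed.

Lemma reach_index u w : hreach B Phi D h u w -> (ix u < ix w)%N.
Proof.
by elim=> [x y [a /hedge_index] //|x y z _ IH1 _]; apply: ltn_trans.
Qed.

Lemma gkmB P Q : GKM P -> GKM Q -> GKM (fun w => P w - Q w).
Proof.
move=> gP gQ u a w e; have -> : P u - Q u - (P w - Q w) = (P u - P w) - (Q u - Q w) by ring.
exact: (dvdmpB (gP _ _ _ e) (gQ _ _ _ e)).
Qed.

Lemma gkmM f P : GKM P -> GKM (fun w => f * P w).
Proof. by move=> gP u a w e; rewrite -mulrBr; apply/dvdmp_mull/gP/e. Qed.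

Lemma gkm_sum (r : seq 'M[R]_n) (c : 'M[R]_n -> mp) (F : 'M[R]_n -> 'M[R]_n -> mp) :
  (forall x, x \in r -> GKM (F x)) -> GKM (fun w => \sum_(x <- r) c x * F x w).
Proof.
move=> gF u a w e; rewrite -sumrB big_seq.
suff : dvdmp (lin D a) (\sum_(i <- r | i \in r) (c i * F i u - c i * F i w)) by [].
elim/big_rec: _ => [|x f /gF gx IH]; first exact: dvdmp0.
by apply: dvdmpD => //; apply: (gkmM (c x) gx e).
Qed.

Lemma inc_neq0 w : inc w != 0.
Proof.
rewrite prodf_seq_neq0; apply/allP => a ap; apply/implyP => _.
by rewrite lin_eq0 root_neq0 // pos_root.
Qed.

Lemma inc_homog w : inc w \is (ell B Phi D h w).-homog.
Proof.
rewrite -big_filter /ell -size_filter; exact: prod_lf_homog.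
Qed.

(** Each incoming label divides [P w] because the value at its source is 0, and the labels are
    pairwise independent. This divisibility drives both the elimination and the spanning
    argument. *)
Lemma inc_dvd P w : GKM P -> (forall u a, hedge B Phi D h u a w -> P u = 0) ->
  dvdmp (inc w) (P w).
Proof.
move=> gP P0; rewrite -big_filter -/(incoming w).
have -> : \prod_(a <- incoming w) lin D a = \prod_(v <- [seq coord D a | a <- incoming w]) lf v.
  by rewrite big_map.
apply: prod_lf_dvd.
- apply/allP => _ /mapP[a /incomingP[u [_ _ ap _ _]] ->].
  by rewrite coord_eq0 root_neq0 // pos_root.
- have up : pairwise [rel a b | a != b] (incoming w).
    by rewrite -uniq_pairwise; apply/filter_uniq/pos_uniq.
  rewrite pairwise_map; apply: sub_in_pairwise (allss _) up => a b.
  move=> /incomingP[u [_ _ ap _ _]] /incomingP[v [_ _ bp _ _]] /= ab; apply/negP => /sub_coord.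
  by apply/negP; apply: (lpos_indep (lpos_full bp) (lpos_full ap)); rewrite eq_sym.
- move=> _ /mapP[a /incomingP[u e] ->]; have [q Eq] := gP _ _ _ e.
  by exists (- q); rewrite mulNr -linE -Eq (P0 _ _ e) sub0r opprK.
Qed.

Lemma triangular_class x : W x -> exists P,
  [/\ GKM P, P x = inc x & forall y, W y -> (ix y < ix x)%N -> P y = 0].
Proof.
move=> Wx; have [P [gP Px Py]] := good_hess (Ordinal (ix_lt Wx)).
pose Q w := if insub (ix w) is Some i then P i else 0.
have QE (i : 'I_N) w : ix w = i -> Q w = P i by move=> E; rewrite /Q E valK.
exists Q; split.
- move=> u a w e; have [Wu Ww _ _ _] := e; pose i := Ordinal (ix_lt Ww).
  have wi : nth 0 s i = w by rewrite /= nth_index //; apply/sW.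
  have ui : hedge B Phi D h u a (nth 0 s i) by rewrite wi.
  rewrite (QE i w) //.
  have [j Ej] : exists j : 'I_N, ix u = j by exists (Ordinal (ix_lt Wu)).
  rewrite (QE j u) //; have := gP i (j, coord D a); apply.
  apply/mapP; exists a; first by apply/incomingP; exists u.
  have [_ _ ap Ew _] := ui; congr (_, _); apply: val_inj.
  rewrite val_insubd Ew -mulmxA reflK ?mulmx1 ?(root_neq0 (pos_root ap)) //.
  by rewrite (ix_lt Wu) Ej.
- rewrite (QE (Ordinal (ix_lt Wx)) x) // Px /euler big_map /= nth_index; last exact/sW.
  by rewrite -[RHS]big_filter.
- by move=> y Wy lt; rewrite (QE (Ordinal (ix_lt Wy)) y) // Py.
Qed.

(* Subtracting multiples of later flow-up classes clears the values outside the
   reachable set, one vertex at a time. *)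
Lemma flowup_exists x : W x -> exists P, FU x P.
Proof.
have [d] := ubnP (N - ix x); elim: d x => // d IH x le Wx.
have later y : W y -> (ix x < ix y)%N -> exists P, FU y P.
  move=> Wy lt; apply: IH => //; rewrite -ltnS (leq_trans _ le) // ltnS ltn_sub2l //.
  exact: ix_lt.
have clear j : exists P, [/\ GKM P, P x = inc x, forall y, W y -> (ix y < ix x)%N -> P y = 0 &
    forall y, W y -> (ix y < j)%N -> P y != 0 -> y = x \/ hreach B Phi D h x y].
  elim: j => [|j [P [gP Px P0 Pj]]].
    by have [P [gP Px P0]] := triangular_class Wx; exists P.
  have [|ltj] := leqP N j.
    move=> Nj; exists P; split=> // y Wy _; apply: Pj => //; exact: leq_trans (ix_lt Wy) Nj.
  set y := nth 0 s j; have Wy : W y by apply/sW/mem_nth.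
  have iy : ix y = j by apply: index_uniq.
  case: (excluded_middle_informative (P y = 0 \/ y = x \/ hreach B Phi D h x y)) => [ok|nok].
    exists P; split=> // z Wz; rewrite ltnS leq_eqVlt => /predU1P[zj|zj]; last exact: Pj.
    have -> : z = y by apply: ix_inj; rewrite // iy.
    by move=> Py; case: ok => // E; rewrite E eqxx in Py.
  have xy : (ix x < ix y)%N.
    rewrite ltnNge leq_eqVlt; apply/negP => /orP[/eqP E|lt]; apply: nok.
      by right; left; apply: ix_inj.
    by left; apply: P0.
  (* A nonzero value at the source of an edge into [y] would make [y] reachable from [x]. *)
  have [r Er] : dvdmp (inc y) (P y).
    apply: inc_dvd => // u a e; have [Wu _ _ _ _] := e.
    apply/eqP; apply: contra_notT nok => Pu; right; right.
    have uj : (ix u < j)%N by rewrite -iy; apply: hedge_index e.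
    case: (Pj u Wu uj Pu) => [<-|xu]; first by apply: t_step; exists a.
    by apply: t_trans xu _; apply: t_step; exists a.
  have [F [[gF _] Fy Fs]] := later y Wy xy.
  have F0 z : W z -> (ix z < ix y)%N -> F z = 0.
    move=> Wz lt; apply/eqP; apply: contraTT lt => /(Fs z Wz)[->|/reach_index];
      rewrite -leqNgt //.
    exact: ltnW.
  exists (fun z => P z - r * F z); split.
  - by apply: gkmB => //; apply: gkmM.
  - by rewrite F0 // mulr0 subr0.
  - by move=> z Wz zx; rewrite P0 // F0 ?mulr0 ?subr0 // (ltn_trans zx).
  - move=> z Wz; rewrite ltnS leq_eqVlt => /predU1P[zj|zj].
      have -> : z = y by apply: ix_inj; rewrite // iy.
      by rewrite Fy -Er subrr eqxx.
    by rewrite F0 ?iy // mulr0 subr0; apply: Pj.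
have [P [gP Px P0 Ps]] := clear N.
(* The component of degree [ell] keeps the value at [x], which is homogeneous of that degree, and
   preserves the edge and support conditions. *)
exists (fun w => pihomog mdeg (ell B Phi D h x) (P w)); split.
- split=> [u a w e|w _ _]; last exact: pihomogP.
  have [q Eq] := gP _ _ _ e; rewrite -raddfB /= Eq linE (pihomog_mulr _ _ (lf_homog _)).
  suff : dvdmp (lf (coord D a)) (if (1 <= ell B Phi D h x)%N
    then pihomog mdeg (ell B Phi D h x - 1) q * lf (coord D a) else 0) by [].
  by case: ifP => _; [eexists | apply: dvdmp0].
- by rewrite Px pihomog_dE // inc_homog.
- move=> y Wy Py; apply: Ps => //; first exact: ix_lt.
  by apply: contraNneq Py => ->; rewrite pihomog0.
Qed.

(** * Spanning and independence *)

Section Basis.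
Variable F : 'M[R]_n -> 'M[R]_n -> mp.
Hypothesis FUF : forall x, W x -> FU x (F x).

Lemma flowup_vanish x y : W x -> W y -> x != y -> (ix y <= ix x)%N -> F x y = 0.
Proof.
move=> Wx Wy xy le; have [_ _ Fs] := FUF Wx; apply/eqP; apply: contraTT le => Fy.
case: (Fs y Wy Fy) => [E|/reach_index]; first by rewrite E eqxx in xy.
by rewrite -ltnNge.
Qed.

(** Agreement is extended one vertex at a time: at the next vertex the error is divisible by the
    diagonal value, and changing that coefficient leaves earlier values alone. *)
Lemma flowup_span P : GKM P -> exists (r : seq 'M[R]_n) (c : 'M[R]_n -> mp),
  (forall x, x \in r -> W x) /\ forall y, W y -> P y = \sum_(x <- r) c x * F x y.
Proof.
move=> gP; have [c Hc] : exists c, forall y, W y -> (ix y < N)%N -> P y = \sum_(x <- s) c x * F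
  x y.
  elim: {1}N => [|j [c Hc]]; first by exists (fun=> 0).
  have [Nj|ltj] := leqP N j.
    by exists c => y Wy _; apply: Hc => //; apply: leq_trans (ix_lt Wy) Nj.
  set y := nth 0 s j; have Wy : W y by apply/sW/mem_nth.
  have iy : ix y = j by apply: index_uniq.
  have gS : GKM (fun w => \sum_(x <- s) c x * F x w).
    by apply: gkm_sum => x /sW/FUF[[]].
  have [r Er] : dvdmp (inc y) (P y - \sum_(x <- s) c x * F x y).
    apply: (inc_dvd (gkmB gP gS)) => u a e; have [Wu _ _ _ _] := e.
    by rewrite -Hc ?subrr // -iy; apply: hedge_index e.
  exists (fun x => c x + (if x == y then r else 0)) => z Wz zj.
  have -> : \sum_(x <- s) (c x + (if x == y then r else 0)) * F x z =
      \sum_(x <- s) c x * F x z + r * F y z.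
    rewrite (eq_bigr (fun x => c x * F x z + (if x == y then r * F x z else 0))); last first.
      by move=> x _; rewrite mulrDl; case: eqP; rewrite ?mul0r.
    rewrite big_split /=; congr (_ + _); rewrite -big_mkcond (big_rem y) ?mem_nth //= eqxx.
    rewrite big_seq_cond big_pred0 ?addr0 // => x; rewrite mem_rem_uniq // inE /=.
    by case: eqP => //; rewrite andbF.
  move: zj; rewrite ltnS leq_eqVlt => /predU1P[zj|zj].
    have -> : z = y by apply: ix_inj; rewrite // iy.
    have [_ -> _] := FUF Wy; by rewrite -Er addrC subrK.
  rewrite -Hc // flowup_vanish ?mulr0 ?addr0 //; last by rewrite iy ltnW.
  by apply: contraTneq zj => <-; rewrite iy ltnn.
by exists s, c; split=> [x /sW //|y Wy]; apply: Hc => //; apply: ix_lt.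
Qed.

(** Evaluation at [x], in increasing order: earlier coefficients are already 0, later classes vanish
    at [x], and the diagonal value is nonzero. *)
Lemma flowup_free (r : seq 'M[R]_n) (c : 'M[R]_n -> mp) : uniq r ->
  (forall x, x \in r -> W x) -> (forall y, W y -> \sum_(x <- r) c x * F x y = 0) ->
  forall x, x \in r -> c x = 0.
Proof.
move=> ur Wr c0 x xr; have [d] := ubnP (ix x); elim: d x xr => // d IH x xr le.
have Wx := Wr x xr; have := c0 x Wx; rewrite (bigD1_seq x) //= big_seq_cond big1 =>
  [|y /andP[yr yx]].
  have [_ -> _] := FUF Wx; rewrite addr0 => /eqP; rewrite mulf_eq0 (negPf (inc_neq0 x)) orbF.
  by move/eqP.
have [lt|ge] := ltnP (ix y) (ix x).
  by rewrite IH ?mul0r // (leq_trans lt).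
by rewrite flowup_vanish ?mulr0 //; apply: Wr.
Qed.

End Basis.
End Enumerated.
End Hess.
End Roots.

Unset Implicit Arguments.

Theorem theorem2p5 (n k : nat) (B : 'M[R]_n) (Phi : seq 'rV[R]_n)
    (D : 'M[R]_(k, n)) (h : pred 'rV[R]_n) :
  sym_posdef B -> root_system B Phi -> is_base Phi D -> hessenberg Phi D h ->
  (forall x, weyl B D x -> exists P, flowup B Phi D h x P) /\
  exists F : 'M[R]_n -> 'M[R]_n -> {mpoly R[k]},
    (forall x, weyl B D x -> flowup B Phi D h x (F x)) /\
    (* spanning *)
    (forall P, gkm B Phi D h P ->
       exists (s : seq 'M[R]_n) (c : 'M[R]_n -> {mpoly R[k]}),
         (forall x, x \in s -> weyl B D x) /\
         forall y, weyl B D y -> P y = \sum_(x <- s) c x * F x y) /\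
    (* linear independence over R[alpha_1..alpha_k] *)
    (forall (s : seq 'M[R]_n) (c : 'M[R]_n -> {mpoly R[k]}),
       uniq s -> (forall x, x \in s -> weyl B D x) ->
       (forall y, weyl B D y -> \sum_(x <- s) c x * F x y = 0) ->
       forall x, x \in s -> c x = 0).
Proof.
move=> pB rs bs hs; have [s [us sW s_above]] := weyl_enum pB rs bs.
have FU := flowup_exists pB rs bs hs us sW s_above; split=> //.
(* Membership is placed under the existential so that choice yields a total family, equal to some
   arbitrary class off the Weyl group. *)
have ex x : exists P, weyl B D x -> flowup B Phi D h x P.
  case: (excluded_middle_informative (weyl B D x)) => [/FU[P FP]|nW]; first by exists P.
  by exists (fun=> 0).
pose F x := proj1_sig (constructive_indefinite_description _ (ex x)).
have FF x : weyl B D x -> flowup B Phi D h x (F x).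
  exact: proj2_sig (constructive_indefinite_description _ (ex x)).
exists F; split=> //; split.
- exact: (flowup_span pB rs bs hs us sW s_above FF).
- exact: (flowup_free pB rs bs hs s_above FF).
Qed.
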